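(* The Bethe subalgebra $\mathcal{B}^S_n(z_1,\dots,z_n)$ tends to the Gelfand–Zetlin subalgebra $\mathcal{G}_n\subset\mathbb{C}[\mathfrak{S}_n]$ as $(z_{a-1}-z_a)/(z_a-z_{a+1})\to0$ for all $a=2,\dots,n-1$.
   Context: $\mathfrak{S}_n$ is the symmetric group. For distinct $r_1,\dots,r_m\in\{1,\dots,n\}$, $\pi^{[n]}_{r_1,\dots,r_m}:\mathbb{C}[\mathfrak{S}_m]\to\mathbb{C}[\mathfrak{S}_n]$ is the embedding induced by $i\mapsto r_i$. $A^{[m]}=\frac1{m!}\sum_{\sigma\in\mathfrak{S}_m}\mathrm{sign}(\sigma)\,\sigma$. For complex $z_1,\dots,z_n$ and $i=1,\dots,n$ put $$\Phi^{[n]}_i(u)=\sum_{1\le r_1<\dots<r_i\le n} i!\;\pi^{[n]}_{r_1,\dots,r_i}(A^{[i]})\prod_{1\le b\le n,\ b\notin\{r_1,\dots,r_i\}}(u-z_b)=\sum_{j=0}^{n-i}\Phi^{[n]}_{i,j}\,u^{n-i-j}.$$ $\mathcal{B}^S_n(z_1,\dots,z_n)$ is the subalgebra of $\mathbb{C}[\mathfrak{S}_n]$ generated by all $\Phi^{[n]}_{i,j}$, $i=1,\dots,n$, $j=0,\dots,n-i$. $\mathcal{G}_n$ is the subalgebra of $\mathbb{C}[\mathfrak{S}_n]$ generated by the images $\pi^{[n]}_{1,\dots,m}(\mathcal{Z}_m)$, $m=1,\dots,n$, where $\mathcal{Z}_m$ is the center of $\mathbb{C}[\mathfrak{S}_m]$.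 ''Tends to'' means convergence of linear subspaces of $\mathbb{C}[\mathfrak{S}_n]$: along any sequence of parameters $(z_1,\dots,z_n)\in\mathbb{C}^n$ satisfying the limit conditions, the subspaces $\mathcal{B}^S_n(z_1,\dots,z_n)$ eventually have dimension $\dim\mathcal{G}_n$ and converge to $\mathcal{G}_n$ in the Grassmannian. *)

(* Defs.v *)
From HB Require Import structures.
From mathcomp Require Import all_boot all_order all_algebra all_fingroup all_field.
From mathcomp Require Import all_classical all_reals all_analysis.
From mathcomp Require Import complex.

Set Implicit Arguments.
Unset Strict Implicit.
Unset Printing Implicit Defensive.

Import Order.TTheory GRing.Theory Num.Theory.
Import numFieldNormedType.Exports.

Local Open Scope classical_set_scope.
Local Open Scope ring_scope.

(* The modulus topology on R[i], as for any abstract numClosedFieldType. *)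
HB.instance Definition _ (R : realType) :=
  PseudoPointedMetric.copy (complex R) ((complex R)^o).

(* K[gT] : the function x stands for the formal sum of the x g *: g.  A type
   alias is used because {ffun gT -> K} itself carries the pointwise product. *)
Definition group_alg (K : fieldType) (gT : finGroupType) : Type :=
  {ffun gT -> K}.

Section GroupAlgebra.
Variables (K : fieldType) (gT : finGroupType).
Local Notation A := (group_alg K gT).

HB.instance Definition _ := Vector.copy A {ffun gT -> K^o}.

Definition ga_elt (g : gT) : A := [ffun h => (h == g)%:R].

Definition ga_mul (x y : A) : A :=
  [ffun h => \sum_(g : gT) x g * y (g^-1 * h)%g].

Lemma ga_mulA : associative ga_mul.
Proof.
move=> x y z; apply/ffunP=> h; rewrite !ffunE.
under eq_bigr => g _ do rewrite ffunE big_distrr /=.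
under [RHS]eq_bigr => g _ do rewrite ffunE big_distrl /=.
rewrite [RHS]exchange_big /=; apply: eq_bigr => g _.
rewrite [RHS](reindex_inj (mulgI g)) /=; apply: eq_bigr => k _.
by rewrite mulrA mulKg invMg mulgA.
Qed.

Lemma ga_mul1r : left_id (ga_elt 1%g) ga_mul.
Proof.
move=> x; apply/ffunP=> h; rewrite ffunE (bigD1 1%g) //= big1 ?addr0.
  by rewrite ffunE eqxx mul1r invg1 mul1g.
by move=> g /negPf g1; rewrite ffunE g1 mul0r.
Qed.

Lemma ga_mulr1 : right_id (ga_elt 1%g) ga_mul.
Proof.
move=> x; apply/ffunP=> h; rewrite ffunE (bigD1 h) //= big1 ?addr0.
  by rewrite ffunE mulVg eqxx mulr1.
move=> g gh; rewrite ffunE -eq_mulVg1 (negPf gh) mulr0 //.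
Qed.

Lemma ga_mulDl : left_distributive ga_mul +%R.
Proof.
move=> x y z; apply/ffunP=> h; rewrite !ffunE -big_split /=.
by apply: eq_bigr => g _; rewrite ffunE mulrDl.
Qed.

Lemma ga_mulDr : right_distributive ga_mul +%R.
Proof.
move=> x y z; apply/ffunP=> h; rewrite !ffunE -big_split /=.
by apply: eq_bigr => g _; rewrite ffunE mulrDr.
Qed.

Lemma ga_elt_neq0 (g : gT) : ga_elt g != 0.
Proof.
by apply/eqP=> /ffunP/(_ g)/eqP; rewrite !ffunE eqxx oner_eq0.
Qed.

HB.instance Definition _ := GRing.Zmodule_isNzRing.Build A
  ga_mulA ga_mul1r ga_mulr1 ga_mulDl ga_mulDr (ga_elt_neq0 1%g).

Lemma ga_scaleAl (a : K) (x y : A) : a *: (x * y) = (a *: x) * y.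
Proof.
apply/ffunP=> h; rewrite !ffunE scaler_sumr.
by apply: eq_bigr => g _; rewrite ffunE; exact: mulrA.
Qed.

HB.instance Definition _ := GRing.Lmodule_isLalgebra.Build K A ga_scaleAl.

Lemma ga_scaleAr (a : K) (x y : A) : a *: (x * y) = x * (a *: y).
Proof.
apply/ffunP=> h; rewrite !ffunE scaler_sumr.
by apply: eq_bigr => g _; rewrite ffunE; exact: mulrCA.
Qed.

HB.instance Definition _ := GRing.Lalgebra_isAlgebra.Build K A ga_scaleAr.
HB.instance Definition _ := Algebra_isFalgebra.Build K A.

End GroupAlgebra.

(* The product of 'S_n is (s * t) i = t (s i), opposite to the usual convention
   for composition.  Passing to the opposite algebra changes neither the linear
   subspaces generated as subalgebras nor the centers, so nothing below depends
   on this choice. *)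

Section SymmetricGroup.
Variables m n : nat.

(* r i |-> r (s i), every point outside the image of r being fixed. *)
Definition perm_push_fun (r : {ffun 'I_m -> 'I_n}) (s : 'S_m) :
  {ffun 'I_n -> 'I_n} :=
  [ffun x => if [pick i | r i == x] is Some i then r (s i) else x].

Lemma perm_push_subproof (r : {ffun 'I_m -> 'I_n}) (s : 'S_m) :
  injective r -> injectiveb (perm_push_fun r s).
Proof.
move=> rI; apply/injectiveP => x y; rewrite !ffunE.
case: pickP => [i /eqP <-|xr]; case: pickP => [j /eqP <-|yr] //.
- by move=> /rI/perm_inj ->.
- by move=> e; have := yr (s i); rewrite e eqxx.
- by move=> e; have := xr (s j); rewrite -e eqxx.
Qed.

(* The default value 1 is only reached when r is not injective. *)
Definition perm_push (r : {ffun 'I_m -> 'I_n}) (s : 'S_m) : 'S_n :=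
  odflt (perm_one _) (insub (perm_push_fun r s)).

Lemma perm_pushE (r : {ffun 'I_m -> 'I_n}) (s : 'S_m) (x : 'I_n) :
  injective r -> perm_push r s x = perm_push_fun r s x.
Proof.
move=> rI; rewrite /perm_push insubT; first exact: perm_push_subproof.
by move=> h; rewrite /= -pvalE.
Qed.

Variable K : fieldType.

Definition ga_push (r : {ffun 'I_m -> 'I_n}) (x : group_alg K 'S_m) :
  group_alg K 'S_n :=
  \sum_(s : 'S_m) x s *: ga_elt K (perm_push r s).

Lemma ga_push_is_linear r : linear (ga_push r).
Proof.
move=> a x y; rewrite /ga_push scaler_sumr -big_split /=.
by apply: eq_bigr => s _; rewrite !ffunE scalerDl scalerA.
Qed.

HB.instance Definition _ r := GRing.isLinear.Build K (group_alg K 'S_m)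
  (group_alg K 'S_n) _ (ga_push r) (ga_push_is_linear r).

End SymmetricGroup.

Section BetheAlgebra.
Variable K : fieldType.

Definition antisymmetrizer m : group_alg K 'S_m :=
  (m`!%:R)^-1 *: \sum_(s : 'S_m) (-1) ^+ s *: ga_elt K s.

Definition increasing m n (r : {ffun 'I_m -> 'I_n}) : bool :=
  [forall a : 'I_m, forall b : 'I_m, (a < b)%N ==> (r a < r b)%N].

Variables (n : nat) (z : 'I_n -> K).

Definition Phi (i : nat) : {poly group_alg K 'S_n} :=
  \sum_(r : {ffun 'I_i -> 'I_n} | increasing r)
    (i`!%:R *: ga_push r (antisymmetrizer i))%:P *
    map_poly (in_alg (group_alg K 'S_n))
      (\prod_(b : 'I_n | b \notin codom r) ('X - (z b)%:P)).

Definition Phi_coef (i j : nat) : group_alg K 'S_n := (Phi i)`_(n - i - j).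

Definition bethe : {vspace group_alg K 'S_n} :=
  agenv (\sum_(1 <= i < n.+1) \sum_(0 <= j < (n - i).+1) <[Phi_coef i j]>)%VS.

End BetheAlgebra.

Section GelfandZetlin.
Variables (K : fieldType) (n : nat).

Definition first_points (m : 'I_n) : {ffun 'I_m.+1 -> 'I_n} :=
  [ffun i => widen_ord (ltn_ord m) i].

(* The summand of index m : 'I_n is the contribution of the group of the first
   m + 1 points. *)
Definition gelfand_zetlin : {vspace group_alg K 'S_n} :=
  agenv (\sum_(m < n)
    (linfun (ga_push (first_points m)) @: 'Z({:group_alg K 'S_m.+1})))%VS.

End GelfandZetlin.

(* The Grassmannian of subspaces of V of all dimensions, i.e., the disjoint
   union over d of the Gr(d, V).  Each Gr(d, V) carries the quotient topology
   of the space of d-frames, which are here the d x (dim V) matrices of rank d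
   (in coordinates on V), under the map sending a frame to its span. *)
Definition grassmannian (K : numFieldType) (V : vectType K) : Type :=
  {vspace V}.

Section Grassmannian.
Variables (K : numFieldType) (V : vectType K).
Local Notation G := (grassmannian V).

HB.instance Definition _ := Choice.copy G {vspace V}.

Definition frame_span d (F : 'M[K]_(d, dim V)) : G :=
  <<[seq VectorInternalTheory.r2v (row i F) | i : 'I_d]>>%VS.

Definition grassmannian_open (U : set G) : Prop :=
  forall (d : nat) (F : 'M[K]_(d, dim V)), row_free F -> U (frame_span F) ->
    \forall F' \near F, row_free F' -> U (frame_span F').

Lemma grassmannian_openT : grassmannian_open setT.
Proof.
move=> d F _ _; have FF := @nbhs_filter _ F.
by apply: (@filterS _ _ FF setT); [move=> F' _ _; exact: I | exact: filterT].
Qed.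

Lemma grassmannian_openI : setI_closed grassmannian_open.
Proof.
move=> U W oU oW d F Ffree [UF WF].
apply: filterS2 (oU d F Ffree UF) (oW d F Ffree WF) => F' UF' WF' F'free.
by split; [exact: UF' | exact: WF'].
Qed.

Lemma grassmannian_open_bigU (I : Type) (f : I -> set G) :
  (forall i, grassmannian_open (f i)) -> grassmannian_open (\bigcup_i f i).
Proof.
move=> of_ d F Ffree [i _ fiF].
by apply: filterS (of_ i d F Ffree fiF) => F' fiF' F'free; exists i => //; exact: fiF'.
Qed.

HB.instance Definition _ := isOpenTopological.Build G
  grassmannian_openT grassmannian_openI grassmannian_open_bigU.

End Grassmannian.

(* Main.v *)
Require Import Defs.
From mathcomp Require Import all_boot all_order all_algebra all_fingroup all_field.
From mathcomp Require Import all_classical all_reals all_analysis.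
From mathcomp Require Import complex.

Import Order.TTheory GRing.Theory Num.Theory.
Import numFieldNormedType.Exports.

Local Open Scope ring_scope.

(** The limit is read off the Jucys-Murphy elements X_a, the sums of the
transpositions (b a) over b < a, the points being numbered from 0.

Up to sign and a multiple of 1, the value of Phi_2 at z_a is a rescaled Gaudin
Hamiltonian: the sum over b <> a of (a b) times the product of the z_a - z_c
over c <> a, b.  Normalized to have coefficient 1 at (a-1 a), it has the
coefficient (z_a - z_(a-1)) / (z_a - z_b) at (a b); consecutive gaps being
negligible before the next one, this tends to 1 if b < a and to 0 if b > a.  So
for every a >= 1 some element y_a of the Bethe algebra tends to X_a
([approx_JM_tends]).  As the X_a generate the Gelfand-Zetlin algebra
([gelfand_zetlin_JMalg]), each element of the latter is a limit of elements of
the Bethe algebras.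

Conversely the Bethe algebra cannot be too large: the y_a commute with all
coefficients of all Phi_i ([hamiltonian_comm_coef]), so the Bethe algebra is
killed by the sum of the squares of the ad(y_a).  This operator tends to the
sum of the squares of the ad(X_a), and the dimension of a kernel is upper
semicontinuous ([near_dim_lker]).  The X_a are self-adjoint for the standard
inner product of the group algebra, so the kernel of the limit operator is the
common centralizer of the X_a, and that is the algebra they generate
([JMalg_max_comm]).  Hence the dimensions eventually agree, and the lifts of a
basis of the Gelfand-Zetlin algebra become bases of the Bethe algebras that
converge to it ([grassmannian_tends]).

For the maximal commutativity one goes up the chain of symmetric groups.  An
element of C[S_(m+1)] that commutes with S_m is a polynomial in X_0, ..., X_m
([centralizer_in_JMalg]): multiplying the S_m-average of a permutation by X_m
appends one more point to the cycle of m, modulo averages of permutations that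
move fewer points.  On the other side, the algebra D_m generated by the X_a with
a < m is commutative and closed under adjoints, so 1 is a sum of projections p
of D_m with p D_m one-dimensional ([projection_resolution]); if D_m is its own
centralizer in C[S_m], then p C[S_m] p is one-dimensional too, and p x p is for
x in C[S_(m+1)] a nonzero multiple of p w p, where w is the S_m-average of
p x p.  So p x p lies in D_(m+1), and an x that commutes with D_(m+1) is the sum
of the p x p. *)

(** * Generated subalgebras *)

Section Generated.
Variables (K : fieldType) (aT : falgType K).

Lemma prodv_ind (U V : {vspace aT}) (P : aT -> Prop) :
    P 0 -> (forall a x y, P x -> P y -> P (a *: x + y)) ->
    (forall u v, u \in U -> v \in V -> P (u * v)) ->
  forall x, x \in (U * V)%VS -> P x.
Proof.
move=> P0 PD PM x; rewrite unlock => /coord_span ->.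
elim/big_ind: _ => // [y1 y2 Py1 Py2|i _].
  by rewrite -[y1]scale1r; exact: PD.
rewrite -[_ *: _]addr0; apply: PD => //=.
have iS : (i < size (allpairs *%R (vbasis U) (vbasis V)))%N.
  by rewrite size_allpairs !size_tuple.
have /allpairsP[[u v] [/= uU vV ->]] := mem_nth 0 iS.
by apply: PM; exact: vbasis_mem.
Qed.

Lemma agenv_ind (U : {vspace aT}) (P : aT -> Prop) :
    P 1 -> (forall a x y, P x -> P y -> P (a *: x + y)) ->
    (forall u x, u \in U -> P x -> P (u * x)) ->
  forall x, x \in agenv U -> P x.
Proof.
move=> P1 PD PM.
have P0 : P 0 by rewrite -(addNr 1) -scaleN1r; exact: PD.
have PX i x : x \in (U ^+ i)%VS -> P x.
  elim: i x => [|i IHi] x.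
    by move=> /vlineP[a ->]; rewrite -[_ *: _]addr0; exact: PD.
  by rewrite expvSl; apply: prodv_ind => // u v uU /IHi; exact: PM.
move=> x /memv_sumP[v vU ->]; elim/big_ind: _ => // [y1 y2 Py1 Py2|i _].
  by rewrite -[y1]scale1r; exact: PD.
exact: PX (vU i isT).
Qed.

Lemma memv_agenvM (U : {vspace aT}) x y :
  x \in agenv U -> y \in agenv U -> x * y \in agenv U.
Proof. by move=> xU yU; rewrite -agenvM memv_mul. Qed.

Lemma memv_agenv1 (U : {vspace aT}) : 1 \in agenv U.
Proof. by rewrite memvE sub1_agenv. Qed.

Lemma agenv_sub (U V : {vspace aT}) : (U <= agenv V -> agenv U <= agenv V)%VS.
Proof. by move=> /agenvS; rewrite agenv_id. Qed.

Lemma agenv_comm (U : {vspace aT}) y :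
  {in U, forall u, u * y = y * u} -> {in agenv U, forall x, x * y = y * x}.
Proof.
move=> yU; apply: agenv_ind; first by rewrite mul1r mulr1.
  by move=> a u v uy vy; rewrite mulrDl mulrDr -scalerAl -scalerAr uy vy.
by move=> u x uU xy; rewrite -mulrA xy !mulrA yU.
Qed.

Lemma agenv_comm2 (U : {vspace aT}) :
  {in U &, commutative *%R} -> {in agenv U &, commutative *%R}.
Proof.
move=> cU x y xU yU; apply: agenv_comm xU => u uU.
by apply/esym; apply: agenv_comm yU => v vU; exact: cU.
Qed.

End Generated.

(** Read off the matrix of f on a basis of U, which has an eigenvector because the
field is algebraically closed. *)
Lemma stable_eigenvector (K : numClosedFieldType) (V : vectType K)
    (f : 'End(V)) (U : {vspace V}) :
    U != 0%VS -> {in U, forall u, f u \in U} ->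
  exists a v, [/\ v \in U, v != 0 & f v = a *: v].
Proof.
rewrite -dimv_eq0 -lt0n => U0 fU; pose b := vbasis U.
have bU i : b`_i \in U.
  case: (ltnP i (size b)) => [ib|ib]; first exact/vbasis_mem/mem_nth.
  by rewrite nth_default // mem0v.
pose M := \matrix_(i < \dim U, j < \dim U) coord b j (f b`_i).
have [a /eigenvalueP[v vM v0]] := eigenvalue_closed M U0.
exists a, (\sum_i v 0 i *: b`_i); split.
- by apply: memv_suml => i _; rewrite memvZ.
- apply: contraNneq v0 => v0.
  have /freeP/(_ _ v0) {}v0 := basis_free (vbasisP U).
  by apply/eqP/rowP => i; rewrite v0 mxE.
rewrite linear_sum scaler_sumr.
under eq_bigr => i _ do
  rewrite linearZ /= (coord_vbasis (fU _ (bU i))) scaler_sumr.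
rewrite exchange_big /=; apply: eq_bigr => j _.
move/rowP: vM => /(_ j); rewrite !mxE => vM.
rewrite scalerA -vM scaler_suml; apply: eq_bigr => i _.
by rewrite scalerA mxE.
Qed.

(** * The group algebra and its adjoint *)

Section GroupAlgebraTheory.
Variables (K : fieldType) (gT : finGroupType).
Local Notation A := (group_alg K gT).
Local Notation e := (ga_elt K).
Implicit Types (x y : A) (g h : gT).

Lemma ga_mulE x y h : (x * y) h = \sum_g x g * y (g^-1 * h)%g.
Proof. by rewrite ffunE. Qed.

Lemma ga_addE x y g : (x + y) g = x g + y g.
Proof. by rewrite ffunE. Qed.

Lemma ga_oppE x g : (- x) g = - x g.
Proof. by rewrite ffunE. Qed.

Lemma ga_scaleE a x g : (a *: x) g = a * x g.
Proof. by rewrite ffunE. Qed.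

Lemma ga_0E g : (0 : A) g = 0.
Proof. by rewrite ffunE. Qed.

Lemma ga_sum_ffunE (I : Type) (r : seq I) (P : pred I) (F : I -> A) g :
  (\sum_(i <- r | P i) F i) g = \sum_(i <- r | P i) F i g.
Proof. by apply: (big_morph (fun x : A => x g)) => [x y|]; rewrite ffunE. Qed.

Lemma ga_eltE g h : e g h = (h == g)%:R.
Proof. by rewrite ffunE. Qed.

Lemma ga_elt_mull g x h : (e g * x) h = x (g^-1 * h)%g.
Proof.
rewrite ga_mulE (bigD1 g) //= big1 ?addr0 ?ga_eltE ?eqxx ?mul1r //.
by move=> k /negPf kg; rewrite ga_eltE kg mul0r.
Qed.

Lemma ga_elt_mulr g x h : (x * e g) h = x (h * g^-1)%g.
Proof.
rewrite ga_mulE (bigD1 (h * g^-1)%g) //= big1 ?addr0.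
  by rewrite ga_eltE invMg invgK mulgKV eqxx mulr1.
move=> k kg; rewrite ga_eltE; case: eqP => [gE|_]; last by rewrite mulr0.
by case/eqP: kg; rewrite -gE invMg invgK mulKVg.
Qed.

Lemma ga_eltM g h : e (g * h)%g = e g * e h.
Proof.
apply/ffunP => k; rewrite ga_elt_mull !ga_eltE; congr (nat_of_bool _)%:R.
by apply/eqP/eqP => [->|<-]; rewrite ?mulKg ?mulKVg.
Qed.

Lemma ga_elt1 : e 1%g = 1 :> A.
Proof. by []. Qed.

Lemma ga_expand x : x = \sum_g x g *: e g.
Proof.
apply/ffunP => h; rewrite ga_sum_ffunE (bigD1 h) //= big1 ?addr0.
  by rewrite ga_scaleE ga_eltE eqxx mulr1.
by move=> g gh; rewrite ga_scaleE ga_eltE eq_sym (negPf gh) mulr0.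
Qed.

Lemma ga_conjE g h x : (e g^-1%g * x * e g) h = x (g * h * g^-1)%g.
Proof. by rewrite ga_elt_mulr ga_elt_mull invgK mulgA. Qed.

Lemma ga_eltJ g h : e g^-1%g * e h * e g = e (h ^ g)%g.
Proof. by rewrite -!ga_eltM conjgE mulgA. Qed.

(** Lets the invariance of sums under a group of permutations be checked by
reindexing. *)
Lemma ga_comm_conj g x : e g^-1%g * x * e g = x <-> x * e g = e g * x.
Proof.
split=> [{2}<-|xg]; first by rewrite !mulrA -ga_eltM mulgV mul1r.
by rewrite -mulrA xg mulrA -ga_eltM mulVg mul1r.
Qed.

End GroupAlgebraTheory.

Section Star.
Variables (K : numClosedFieldType) (gT : finGroupType).
Local Notation A := (group_alg K gT).
Local Notation e := (ga_elt K).
Implicit Types (x y : A) (g h : gT).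

(** The adjoint for the Hermitian form in which the group elements are
orthonormal; the form itself appears below as (x * star y) 1. *)
Definition star x : A := [ffun g => (x g^-1%g)^*].

Lemma starE x g : star x g = (x g^-1%g)^*.
Proof. by rewrite ffunE. Qed.

Lemma starK x : star (star x) = x.
Proof. by apply/ffunP => g; rewrite !starE invgK conjCK. Qed.

Lemma starD x y : star (x + y) = star x + star y.
Proof. by apply/ffunP => g; rewrite !(starE, ga_addE) rmorphD. Qed.

Lemma starZ a x : star (a *: x) = a^* *: star x.
Proof. by apply/ffunP => g; rewrite !(starE, ga_scaleE) rmorphM. Qed.

Lemma star0 : star 0 = 0.
Proof. by apply/ffunP => g; rewrite !(starE, ga_0E) conjC0. Qed.

Lemma starB x y : star (x - y) = star x - star y.
Proof. by rewrite -scaleN1r starD starZ rmorphN1 scaleN1r. Qed.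

Lemma star_sum (I : Type) (r : seq I) (P : pred I) (F : I -> A) :
  star (\sum_(i <- r | P i) F i) = \sum_(i <- r | P i) star (F i).
Proof. by apply: (big_morph star starD star0). Qed.

Lemma star_elt g : star (e g) = e g^-1%g.
Proof.
apply/ffunP => h; rewrite starE !ga_eltE rmorph_nat.
by congr (nat_of_bool _)%:R; rewrite eq_invg_sym eq_sym.
Qed.

Lemma star1 : star 1 = 1.
Proof. by rewrite -ga_elt1 star_elt invg1. Qed.

Lemma starM x y : star (x * y) = star y * star x.
Proof.
apply/ffunP => h; rewrite starE !ga_mulE rmorph_sum /=.
rewrite (reindex_inj (mulgI h^-1%g)) /=; apply: eq_bigr => g _.
by rewrite rmorphM !starE !invMg !invgK mulgK mulrC.
Qed.

(** This coefficient is the squared norm of x, whence the positivity that replaces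
semisimplicity in what follows. *)
Lemma star_sq1 x : (x * star x) 1%g = \sum_g `|x g| ^+ 2.
Proof.
rewrite ga_mulE; apply: eq_bigr => g _.
by rewrite starE mulg1 invgK normCK.
Qed.

Lemma star_sq_sum_eq0 (I : finType) (F : I -> A) :
  \sum_i (F i * star (F i)) 1%g = 0 -> forall i, F i = 0.
Proof.
move=> /eqP; rewrite psumr_eq0; last first.
  by move=> i _; rewrite star_sq1 sumr_ge0 // => g _; rewrite exprn_ge0.
move=> /allP Fi0 i; apply/ffunP => g; rewrite ga_0E.
have := Fi0 i (mem_index_enum i); rewrite /= star_sq1 psumr_eq0; last first.
  by move=> h _; rewrite exprn_ge0.
by move=> /allP/(_ g (mem_index_enum g)); rewrite /= expf_eq0 /= normr_eq0 => /eqP.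
Qed.

Lemma star_sq_eq0 x : x * star x = 0 -> x = 0.
Proof.
move=> x0; apply: (@star_sq_sum_eq0 'I_1 (fun=> x) _ ord0).
by rewrite big_ord1 x0 ga_0E.
Qed.

Lemma ga_trace_comm x y : (x * y) 1%g = (y * x) 1%g.
Proof.
rewrite !ga_mulE (reindex_inj invg_inj) /=; apply: eq_bigr => g _.
by rewrite !mulg1 invgK mulrC.
Qed.

Lemma star_mul_eq0 x : star x * x = 0 -> x = 0.
Proof.
rewrite -{2}(starK x) => /star_sq_eq0/(congr1 star).
by rewrite starK star0.
Qed.

End Star.
(** * Projections in a commutative self-adjoint subalgebra *)

Section StarSpectral.
Variables (K : numClosedFieldType) (gT : finGroupType).
Local Notation A := (group_alg K gT).
Variable C : {vspace A}.
Hypotheses (C1 : 1 \in C) (CM : {in C &, forall x y, x * y \in C}).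
Hypotheses (CS : {in C, forall x, star _ _ x \in C}).
Hypothesis (cC : {in C &, commutative *%R}).
Local Notation star := (star K gT).

(** Orthogonal projections, seen as self-adjoint idempotents. *)
Definition projection_in (f : A) := [/\ f \in C, star f = f & f * f = f].

(** In a commutative algebra an idempotent f is normal, and then the norm of
f - f f* vanishes. *)
Lemma idem_projection f : f \in C -> f * f = f -> star f = f.
Proof.
move=> fC ff; have sfC := CS _ fC.
suff fE : f = f * star f by rewrite {1}fE starM starK -fE.
apply/eqP; rewrite -subr_eq0; apply/eqP/star_sq_eq0.
have sff : star f * star f = star f by rewrite -starM ff.
rewrite starB starM starK mulrBl !mulrBr !mulrA ff.
rewrite -[f * star f * f]mulrA (cC _ _ sfC fC) !mulrA ff.
by rewrite -[f * star f * star f]mulrA sff !subrr.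
Qed.

(** Subtracting an eigenvalue makes t a nonzero zero divisor u of the algebra f C;
the projection onto the ideal generated by u* u is then neither 0 nor f. *)
Lemma proper_projection f t :
    projection_in f -> t \in C -> f * t = t -> (forall a, t != a *: f) ->
  exists f1, [/\ projection_in f1, f * f1 = f1, f1 != f & f1 != 0].
Proof.
move=> [fC sf ff] tC ft tNf.
have imP x : x \in C -> f * x = x -> x \in (amull f @: C)%VS.
  by move=> xC fx; apply/memv_imgP; exists x; rewrite // lfunE.
have imE x : x \in (amull f @: C)%VS -> x \in C /\ f * x = x.
  by move=> /memv_imgP[z zC ->]; rewrite !lfunE /= mulrA ff CM.
have [||l [y [/imE[yC fy] y0]]] :=
    @stable_eigenvector _ _ (amull t) (amull f @: C)%VS.
- apply: contraTneq (imP _ tC ft) => ->; rewrite memv0.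
  by rewrite -(scale0r f); exact: tNf.
- by move=> x /imE[xC fx]; rewrite lfunE /=; apply: imP; rewrite ?CM // mulrA ft.
rewrite lfunE /= => ty.
pose u := t - l *: f.
have uC : u \in C by rewrite memvB ?memvZ.
have u0 : u != 0 by rewrite subr_eq0.
have uy : u * y = 0 by rewrite mulrBl ty -scalerAl fy subrr.
pose a := star u * u.
have aC : a \in C by rewrite CM ?CS.
have sa : star a = a by rewrite starM starK.
have a0 : a != 0 by apply: contraNneq u0 => /star_mul_eq0 ->.
have ay : a * y = 0 by rewrite -mulrA uy mulr0.
have fa : f * a = a.
  rewrite (cC _ _ fC aC) -mulrA mulrBl -scalerAl ff.
  by rewrite (cC _ _ tC fC) ft.
(* As a is self-adjoint, multiplication by a is injective, hence bijective, on
   the ideal a C; so a = a (a c) for some c, and a c is the projection onto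
   that ideal. *)
pose I := (amull a @: C)%VS.
have : a \in (amull a @: I)%VS.
  suff -> : (amull a @: I = I)%VS.
    by apply/memv_imgP; exists 1; rewrite // lfunE /= mulr1.
  apply/eqP; rewrite eqEdim; apply/andP; split.
    apply/subvP => _ /memv_imgP[_ /memv_imgP[x xC ->] ->].
    by rewrite memv_img // lfunE CM.
  rewrite limg_dim_eq //; apply/eqP; rewrite -subv0; apply/subvP => w.
  rewrite memv_cap => /andP[/memv_imgP[x xC ->]].
  rewrite memv_ker !lfunE /= memv0 => /eqP aax; apply/eqP/star_mul_eq0.
  by rewrite starM sa -mulrA aax mulr0.
move=> /memv_imgP[_ /memv_imgP[c cC' ->]]; rewrite !lfunE /= => aE.
have acC : a * c \in C by rewrite CM.
have acac : a * c * (a * c) = a * c.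
  by rewrite {1}(cC _ _ aC cC') -mulrA -aE (cC _ _ cC' aC).
exists (a * c); split.
- by split=> //; exact: idem_projection.
- by rewrite mulrA fa.
- apply: contraNneq y0 => acf.
  by rewrite -fy -acf (cC _ _ aC cC') -mulrA ay mulr0.
- by apply: contraNneq a0 => ac0; rewrite aE ac0 mulr0.
Qed.

(** Split f by a proper projection f1 into f1 and f - f1, as long as f C is not a
line; both cut out ideals of smaller dimension. *)
Lemma projection_resolution f : projection_in f ->
  exists s : seq A, [/\ forall p, p \in s -> projection_in p,
    \sum_(p <- s) p = f
    & forall p c, p \in s -> c \in C -> exists a, p * c = a *: p].
Proof.
move: {2}_.+1 (ltnSn (\dim (amull f @: C))) => N.
elim: N f => // N IHN f dimf pf; have [fC sf ff] := pf.
have [scal|] := pselect (forall c, c \in C -> exists a, f * c = a *: f).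
  exists [:: f]; split=> [p||p c]; rewrite ?big_seq1 // inE => /eqP-> //.
  exact: scal.
move=> /existsNP[c /not_implyP[cC' /forallNP nc]].
have [||a|f1 [pf1 ff1 f1f f10]] := @proper_projection f (f * c) pf.
- by rewrite CM.
- by rewrite mulrA ff.
- by apply/eqP; exact: nc.
have [f1C sf1 f1f1] := pf1.
have f1fE : f1 * f = f1 by rewrite (cC _ _ f1C fC).
have smaller g : g \in C -> g * g = g -> f * g = g -> g != f ->
    (\dim (amull g @: C) < N)%N.
  move=> gC gg fg gf; rewrite -ltnS (leq_trans _ dimf) // ltnS.
  have sub : (amull g @: C <= amull f @: C)%VS.
    apply/subvP => _ /memv_imgP[x xC ->]; apply/memv_imgP; exists (g * x).
      exact: CM.
    by rewrite !lfunE /= mulrA fg.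
  rewrite ltn_neqAle dimvS // andbT; apply: contraNneq gf => dimE.
  have /eqP gfE : (amull g @: C == amull f @: C)%VS by rewrite eqEdim sub dimE leqnn.
  have : f \in (amull f @: C)%VS.
    by apply/memv_imgP; exists f; rewrite // lfunE /= ff.
  rewrite -gfE => /memv_imgP[x xC]; rewrite lfunE /= => fE.
  by rewrite -fg (cC _ _ fC gC) fE mulrA gg.
have pf2 : projection_in (f - f1).
  split; first exact: memvB.
    by rewrite starB sf sf1.
  by rewrite mulrBl !mulrBr ff ff1 f1f1 f1fE subrr subr0.
have [f2C sf2 f2f2] := pf2.
have [s1 [ps1 sum1 scal1]] := IHN f1 (smaller _ f1C f1f1 ff1 f1f) pf1.
have [|s2 [ps2 sum2 scal2]] := IHN (f - f1) _ pf2.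
  apply: smaller; rewrite // ?mulrBr ?ff ?ff1 //.
  by rewrite -subr_eq0 addrAC subrr sub0r oppr_eq0.
exists (s1 ++ s2); split.
- by move=> p; rewrite mem_cat => /orP[/ps1|/ps2].
- by rewrite big_cat /= sum1 sum2 addrC subrK.
- by move=> p d; rewrite mem_cat => /orP[/scal1|/scal2] sc /sc.
Qed.

End StarSpectral.
(** * Jucys-Murphy elements and centralizers *)

Section JucysMurphy.
Variables (K : numFieldType) (n : nat).
Local Notation A := (group_alg K 'S_n).
Local Notation e := (ga_elt K).
Implicit Types (x y : A) (g h : 'S_n) (a b p : 'I_n).

(** The copy of the symmetric group of the first m points inside S_n.  Working with
these subgroups keeps the whole chain of group algebras in one ring. *)
Definition Sym_below (m : nat) : {group 'S_n} :=
  ('C([set x : 'I_n | (m <= x)%N] | 'P))%G.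

Lemma Sym_belowP m g : reflect (forall a, (m <= a)%N -> g a = a) (g \in Sym_below m).
Proof.
apply: (iffP astabP) => gfix a; first by move=> ma; apply: gfix; rewrite inE.
by rewrite inE => /gfix.
Qed.

Lemma Sym_below_sub m m' : (m <= m')%N -> {subset Sym_below m <= Sym_below m'}.
Proof.
by move=> mm' g /Sym_belowP gm; apply/Sym_belowP => a /(leq_trans mm'); exact: gm.
Qed.

Lemma Sym_below0 g : g \in Sym_below 0 -> g = 1%g.
Proof. by move=> /Sym_belowP g1; apply/permP => a; rewrite perm1 g1. Qed.

Lemma Sym_below_full g : g \in Sym_below n.
Proof. by apply/Sym_belowP => a; rewrite leqNgt ltn_ord. Qed.

Lemma Sym_below_fix m g a : g \in Sym_below m -> (m <= a)%N -> g a = a.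
Proof. by move=> /Sym_belowP; exact. Qed.

Lemma Sym_below_lt m g a : g \in Sym_below m -> (g a < m)%N = (a < m)%N.
Proof.
move=> gm; have lt h b : h \in Sym_below m -> (b < m)%N -> (h b < m)%N.
  move=> hm bm; rewrite ltnNge; apply/negP => mhb.
  have /Sym_belowP/(_ _ mhb)/perm_inj hb := hm.
  by rewrite hb leqNgt bm in mhb.
by apply/idP/idP => [/(lt _ _ (groupVr gm))|/lt->//]; rewrite permK.
Qed.

Lemma tperm_Sym_below m a b : (a < m)%N -> (b < m)%N -> tperm a b \in Sym_below m.
Proof.
move=> am bm; apply/Sym_belowP => c mc; apply: tpermD.
  by apply: contraTneq am => ->; rewrite -leqNgt.
by apply: contraTneq bm => ->; rewrite -leqNgt.
Qed.

Definition supported (m : nat) x := forall g, g \notin Sym_below m -> x g = 0.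
Definition invariant (m : nat) x := forall h, h \in Sym_below m -> x * e h = e h * x.

Lemma supported_elt m g : g \in Sym_below m -> supported m (e g).
Proof.
by move=> gm h; rewrite ga_eltE; case: eqP => // ->; rewrite gm.
Qed.

Lemma supported1 m : supported m 1.
Proof. exact/supported_elt/group1. Qed.

Lemma supportedD m c x y :
  supported m x -> supported m y -> supported m (c *: x + y).
Proof. by move=> xm ym g gm; rewrite ga_addE ga_scaleE xm ?ym // mulr0 addr0. Qed.

Lemma supported_sum m (I : Type) (r : seq I) (P : pred I) (F : I -> A) :
  (forall i, P i -> supported m (F i)) ->
  supported m (\sum_(i <- r | P i) F i).
Proof.
move=> Fm; elim/big_ind: _ => // [g _|x y xm ym]; first by rewrite ga_0E.
by rewrite -(scale1r x); exact: supportedD.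
Qed.

Lemma supportedM m x y : supported m x -> supported m y -> supported m (x * y).
Proof.
move=> xm ym g gm; rewrite ga_mulE big1 // => h _.
have [hm|/xm->] := boolP (h \in Sym_below m); last by rewrite mul0r.
by rewrite ym ?mulr0 // groupMl // groupV.
Qed.

Lemma supportedS m m' x : (m <= m')%N -> supported m x -> supported m' x.
Proof. by move=> mm' xm g gm'; rewrite xm //; apply: contraNN gm'; exact: Sym_below_sub. Qed.

Lemma invariantS m m' x : (m <= m')%N -> invariant m' x -> invariant m x.
Proof. by move=> mm' xm h hm; apply: xm; exact: Sym_below_sub hm. Qed.

Lemma invariant_comm m x y : invariant m x -> supported m y -> x * y = y * x.
Proof.
move=> xm ym; rewrite (ga_expand _ _ y) mulr_sumr mulr_suml.
apply: eq_bigr => g _; rewrite -scalerAr -scalerAl.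
by have [/xm->|/ym->] := boolP (g \in Sym_below m); rewrite ?scale0r.
Qed.

Definition average (m : nat) x := \sum_(h in Sym_below m) e h^-1%g * x * e h.

Lemma average_invariant m x : invariant m (average m x).
Proof.
move=> k km; apply/ga_comm_conj; rewrite mulr_sumr mulr_suml.
rewrite [RHS](reindex_inj (mulIg k)) /=; apply: eq_big => [h|h _].
  by rewrite groupMr.
by rewrite invMg !ga_eltM !mulrA.
Qed.

Lemma average_supported m m' x :
  (m <= m')%N -> supported m' x -> supported m' (average m x).
Proof.
move=> mm' xm; apply: supported_sum => h /(Sym_below_sub _ _ mm') hm.
by do 2?apply: supportedM => //; apply: supported_elt; rewrite ?groupV.
Qed.

Lemma average_id m x : invariant m x -> average m x = #|Sym_below m|%:R *: x.
Proof.
move=> xm; rewrite scaler_nat -sumr_const; apply: eq_bigr => h hm.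
by apply/ga_comm_conj/xm.
Qed.

Lemma average_expand m x : average m x = \sum_g x g *: average m (e g).
Proof.
rewrite {1}(ga_expand _ _ x).
rewrite /average; under [RHS]eq_bigr => g _ do rewrite scaler_sumr.
rewrite exchange_big /=; apply: eq_bigr => h _.
rewrite mulr_sumr mulr_suml; apply: eq_bigr => g _.
by rewrite -scalerAr -scalerAl.
Qed.

Lemma average_elt m g : average m (e g) = \sum_(h in Sym_below m) e (g ^ h)%g.
Proof. by apply: eq_bigr => h _; rewrite ga_eltJ. Qed.

Lemma average_eltJ m g k : k \in Sym_below m -> average m (e (g ^ k)%g) = average m (e g).
Proof.
move=> km; rewrite !average_elt [RHS](reindex_inj (mulgI k)) /=.
by apply: eq_big => [h|h _]; rewrite ?groupMl // conjgM.
Qed.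

Definition JM a : A := \sum_(b : 'I_n | (b < a)%N) e (tperm b a).

Definition JMalg (m : nat) : {vspace A} :=
  agenv (\sum_(a : 'I_n | (a < m)%N) <[JM a]>)%VS.

Lemma JM_in m a : (a < m)%N -> JM a \in JMalg m.
Proof.
move=> am; apply: (subvP (sub_agenv _)).
by apply: (subvP (sumv_sup a am (subvv _))); exact: memv_line.
Qed.

Lemma JMalgM m : {in JMalg m &, forall x y, x * y \in JMalg m}.
Proof. exact: memv_agenvM. Qed.

Lemma JMalg1 m : 1 \in JMalg m.
Proof. exact: memv_agenv1. Qed.

Lemma JMalg_ind m (P : A -> Prop) :
    P 1 -> (forall c x y, P x -> P y -> P (c *: x + y)) ->
    (forall a x, (a < m)%N -> P x -> P (JM a * x)) ->
  forall x, x \in JMalg m -> P x.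
Proof.
move=> P1 PD PM x; apply: agenv_ind => // u y /memv_sumP[v vJ ->] Py.
have P0 : P 0 by rewrite -(addNr 1) -scaleN1r; exact: PD.
rewrite mulr_suml; elim/big_ind: _ => // [y1 y2 Py1 Py2|a am].
  by rewrite -[y1]scale1r; exact: PD.
have /vlineP[c ->] := vJ a am; rewrite -scalerAl -[_ *: _]addr0.
by apply: PD => //; exact: PM.
Qed.

Lemma JMalgS m m' : (m <= m')%N -> {subset JMalg m <= JMalg m'}.
Proof.
move=> mm' x; move: x; apply: JMalg_ind => [|c x y xD yD|a x am xD].
- exact: JMalg1.
- by rewrite memvD ?memvZ.
- by rewrite JMalgM // JM_in // (leq_trans am).
Qed.

Lemma JM_supported m a : (a < m)%N -> supported m (JM a).
Proof.
move=> am; apply: supported_sum => b ba; apply: supported_elt.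
by rewrite tperm_Sym_below // (ltn_trans ba).
Qed.

(** Conjugation by a permutation of the points below a permutes the summands of
X_a.  As X_b is supported on the permutations of the points below a for b < a,
the Jucys-Murphy elements commute. *)
Lemma JM_invariant a : invariant a (JM a).
Proof.
move=> h ha; apply/ga_comm_conj; rewrite mulr_sumr mulr_suml.
rewrite [RHS](reindex_inj (@perm_inj _ h)) /=.
apply: eq_big => [b|b _]; first by rewrite (Sym_below_lt _ _ _ ha).
by rewrite ga_eltJ tpermJ (Sym_below_fix _ _ a ha) //.
Qed.

Lemma JM_comm a b : JM a * JM b = JM b * JM a.
Proof.
have comm (c d : 'I_n) : (c < d)%N -> JM c * JM d = JM d * JM c.
  by move=> cd; apply/esym/invariant_comm; [exact: JM_invariant|exact: JM_supported].
by have [/comm|/comm|/val_inj->] := ltngtP a b.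
Qed.

Lemma JMalg_comm m : {in JMalg m &, commutative *%R}.
Proof.
apply: agenv_comm2 => x y /memv_sumP[v vJ ->] /memv_sumP[w wJ ->].
rewrite mulr_suml mulr_sumr; apply: eq_bigr => a am.
rewrite mulr_suml mulr_sumr; apply: eq_bigr => b bm.
have /vlineP[c ->] := vJ a am; have /vlineP[d ->] := wJ b bm.
by rewrite -!scalerAr -!scalerAl JM_comm !scalerA mulrC.
Qed.

Lemma JMalg_supported m x : x \in JMalg m -> supported m x.
Proof.
move: x; apply: JMalg_ind => [|c x y|a x am xm].
- exact: supported1.
- exact: supportedD.
- by apply: supportedM => //; exact: JM_supported.
Qed.

(** The degree of a permutation for the induction in [average_in_JMalg]: the marked
point p is not counted, so that multiplying by a transposition (j p) raises it
by at most 1. *)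
Definition moved_off p g := #|[set a | (a != p) && (g a != a)]|.

(** Induction on the degree of g.  If g moves p, then deleting i = g p from its
cycle gives a permutation g1 of smaller degree, and X_p times the average of g1
is a positive multiple of the average of g plus averages of permutations of
degree at most that of g1.  If g fixes p, its average is central in the group
algebra of the points below p. *)
Lemma average_in_JMalg p :
    (forall x, supported p x -> invariant p x -> x \in JMalg p) ->
  forall g, g \in Sym_below p.+1 -> average p (e g) \in JMalg p.+1.
Proof.
move=> cent g; move: {2}_.+1 (ltnSn (moved_off p g)) => N.
elim: N g => // N IHN g degg gS.
have [gp|gp] := eqVneq (g p) p.
  have gSp : g \in Sym_below p.
    apply/Sym_belowP => a; rewrite leq_eqVlt => /orP[/eqP/val_inj<-//|].
    by move: a; apply/Sym_belowP.
  apply: (JMalgS _ _ (leqnSn p)); apply: cent; last exact: average_invariant.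
  exact/average_supported/supported_elt.
pose i := g p; pose g1 : 'S_n := (tperm i p * g)%g.
have g1i : g1 i = i by rewrite permM tpermL.
have g1off a : a != i -> a != p -> g1 a = g a.
  by move=> ai ap; rewrite permM tpermD // eq_sym.
have ip : (i < p)%N.
  rewrite ltn_neqAle gp /= -ltnS Sym_below_lt //.
have g1S : g1 \in Sym_below p.+1.
  by rewrite groupM // tperm_Sym_below // ltnS ltnW.
have gi : g i != i by apply: contraNneq gp => /perm_inj/eqP.
pose M (h : 'S_n) := [set a | (a != p) && (h a != a)].
have Mg1 : M g1 \proper M g.
  apply/properP; split.
    apply/fintype.subsetP => a; rewrite !inE => /andP[ap g1a].
    apply/andP; split=> //; have ai : a != i by apply: contraNneq g1a => ->; rewrite g1i.
    by rewrite -g1off.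
  exists i; rewrite inE; first exact/andP.
    by rewrite negb_and g1i eqxx orbT.
have deg1 : (moved_off p g1 < moved_off p g)%N by exact: proper_card.
have g1avg : average p (e g1) \in JMalg p.+1.
  by apply: IHN => //; exact: leq_trans deg1 (ltnSE degg).
(* Multiplying the average of g1 by X_p adds to g1 one more point j < p.  If
   g1 fixes j, the result is conjugate to g under the permutations of the
   points below p; otherwise no new point is moved. *)
have prodE : JM p * average p (e g1) =
    \sum_(j : 'I_n | (j < p)%N) average p (e (tperm j p * g1)%g).
  under eq_bigr => j _ do rewrite average_elt.
  rewrite exchange_big average_elt mulr_sumr /=; apply: eq_bigr => h hp.
  rewrite mulr_suml.
  rewrite [LHS](reindex_inj (@perm_inj _ h)) /=.
  apply: eq_big => [b|b _]; first by rewrite (Sym_below_lt _ _ _ hp).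
  by rewrite (conjMg _ g1) tpermJ (Sym_below_fix _ _ p hp) // [RHS]ga_eltM.
have fixE (j : 'I_n) : (j < p)%N -> g1 j = j ->
    average p (e (tperm j p * g1)%g) = average p (e g).
  move=> jp g1j.
  suff -> : (tperm j p * g1 = g ^ tperm i j)%g.
    by apply: average_eltJ; rewrite tperm_Sym_below.
  have {1}-> : g = (tperm i p * g1)%g by rewrite mulgA tperm2 mul1g.
  rewrite conjMg tpermJ tpermL tpermD; last 2 first.
  - by rewrite eq_sym neq_ltn ip orbT.
  - by rewrite eq_sym neq_ltn jp orbT.
  congr (_ * _)%g; have kg1 : (tperm i j ^ g1 = tperm i j)%g.
    by rewrite tpermJ g1i g1j.
  by rewrite conjgE -{2}kg1 -conjgC mulKg.
have stepE : JM p * average p (e g1) =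
    \sum_(j : 'I_n | (j < p)%N && (g1 j != j)) average p (e (tperm j p * g1)%g)
    + #|[set j : 'I_n | (j < p)%N && (g1 j == j)]|%:R *: average p (e g).
  rewrite prodE (bigID (fun j => g1 j == j)) /= addrC; congr (_ + _).
  rewrite (eq_bigr (fun=> average p (e g))).
    by rewrite scaler_nat -sumr_const; apply: eq_bigl => j; rewrite inE.
  by move=> j /andP[jp /eqP]; exact: fixE.
have cnt0 : #|[set j : 'I_n | (j < p)%N && (g1 j == j)]|%:R != 0 :> K.
  rewrite pnatr_eq0 cards_eq0; apply/set0Pn; exists i.
  by rewrite inE ip g1i eqxx.
have : #|[set j : 'I_n | (j < p)%N && (g1 j == j)]|%:R *: average p (e g)
    \in JMalg p.+1.
  rewrite -[X in X \in _](addKr (\sum_(j : 'I_n | (j < p)%N && (g1 j != j))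
    average p (e (tperm j p * g1)%g))) -stepE addrC.
  rewrite memvB ?JMalgM ?JM_in //; apply: memv_suml => j /andP[jp g1j].
  apply: IHN; last by rewrite groupM // tperm_Sym_below // ltnS ltnW.
  rewrite (leq_trans _ (ltnSE degg)) // (leq_ltn_trans _ deg1) //.
  apply/subset_leq_card/fintype.subsetP => a; rewrite !inE => /andP[ap].
  rewrite ap permM; have [->|aj] := eqVneq a j; first by rewrite g1j.
  by rewrite tpermD // eq_sym.
by rewrite rpredZeq (negPf cnt0).
Qed.

(** An invariant element is a multiple of its own average, hence a combination of
averages of permutations. *)
Lemma invariant_in_JMalg p :
    (forall x, supported p x -> invariant p x -> x \in JMalg p) ->
  forall x, supported p.+1 x -> invariant p x -> x \in JMalg p.+1.
Proof.
move=> cent x xS xI.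
have H0 : #|Sym_below p|%:R != 0 :> K by rewrite pnatr_eq0 -lt0n cardG_gt0.
have : #|Sym_below p|%:R *: x \in JMalg p.+1.
  rewrite -average_id // average_expand; apply: memv_suml => g _.
  have [gS|/xS->] := boolP (g \in Sym_below p.+1); last by rewrite scale0r mem0v.
  by rewrite memvZ // average_in_JMalg.
by rewrite rpredZeq (negPf H0).
Qed.

Lemma supported0 x : supported 0 x -> x = x 1%g *: 1.
Proof.
move=> x0; apply/ffunP => g; rewrite ga_scaleE -ga_elt1 ga_eltE.
case: eqP => [->|g1]; first by rewrite mulr1.
by rewrite mulr0 x0 //; apply: contra_notN g1; exact: Sym_below0.
Qed.

(** Central elements are in particular invariant under the smaller symmetric
group, so the previous lemma feeds its own hypothesis by induction. *)
Lemma central_in_JMalg m x :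
  (m <= n)%N -> supported m x -> invariant m x -> x \in JMalg m.
Proof.
elim: m x => [|m IHm] x mn xS xI.
  by rewrite (supported0 _ xS) memvZ // JMalg1.
apply: (@invariant_in_JMalg (Ordinal mn)) => //.
  by move=> y yS yI; apply: IHm => //; exact: ltnW.
exact: invariantS xI.
Qed.

Lemma centralizer_in_JMalg p x :
  supported p.+1 x -> invariant p x -> x \in JMalg p.+1.
Proof.
apply: invariant_in_JMalg => y; apply: central_in_JMalg; exact: ltnW.
Qed.

End JucysMurphy.

(** * Maximal commutativity of the Jucys-Murphy algebra *)

Section MaximalCommutativity.
Variables (K : numClosedFieldType) (n : nat).
Local Notation e := (ga_elt K).
Local Notation star := (star K 'S_n).
Local Notation JM := (JM K n).
Local Notation JMalg := (JMalg K n).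
Local Notation Sym_below := (Sym_below n).
Local Notation supported := (supported K n).
Local Notation average := (average K n).
Implicit Types (x : group_alg K 'S_n) (h : 'S_n).

Lemma star_JM a : star (JM a) = JM a.
Proof. by rewrite star_sum; apply: eq_bigr => b _; rewrite star_elt tpermV. Qed.

Lemma JMalg_star m : {in JMalg m, forall x, star x \in JMalg m}.
Proof.
apply: JMalg_ind => [|c x y xD yD|a x am xD].
- by rewrite star1 JMalg1.
- by rewrite starD starZ memvD ?memvZ.
- by rewrite starM star_JM JMalgM ?JM_in.
Qed.

(** Here D_m stands for the algebra JMalg m.  For a projection p of the resolution
of 1 in D_m, every p h p with h a permutation of the first m points commutes
with D_m, hence lies in it by induction and is a multiple chi(h) p.  Averaging
p x p over those h gives w with p w p = (sum of |chi(h)|^2) (p x p), and the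
factor is positive because chi(1) = 1; while w lies in D_(m+1) as it commutes
with the smaller group. *)
Lemma JMalg_max_comm m x : (m <= n)%N -> supported m x ->
  {in JMalg m, forall d, d * x = x * d} -> x \in JMalg m.
Proof.
elim: m x => [|m IHm] x mn xS xD.
  by rewrite (supported0 _ _ _ xS) memvZ // JMalg1.
pose q : 'I_n := Ordinal mn.
have [s [ps sum1 scal]] := @projection_resolution K _ (JMalg m) (JMalg1 K n m) (JMalgM K n m)
  (JMalg_star m) (JMalg_comm K n m) 1
  (And3 (JMalg1 K n m) (star1 K _) (mulr1 1)).
have xE : x = \sum_(p <- s) p * x * p.
  rewrite -[LHS]mul1r -sum1 mulr_suml big_seq [RHS]big_seq.
  apply: eq_bigr => p /ps[pD _ pp].
  by rewrite -mulrA -(xD p) ?mulrA ?pp // (JMalgS _ _ m).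
rewrite xE big_seq; apply: memv_suml => p pS.
have [pD sp pp] := ps p pS.
have [->|p0] := eqVneq p 0; first by rewrite mulr0 mem0v.
have pSupp := JMalg_supported _ _ _ _ pD.
have chiP h : exists c, h \in Sym_below m -> p * e h * p = c *: p.
  have [hm|_] := boolP (h \in Sym_below m); last by exists 0.
  have phS : supported m (p * e h * p).
    by do 2?apply: supportedM => //; exact: supported_elt.
  have : p * e h * p \in JMalg m.
    apply: IHm => //; first exact: ltnW.
    move=> d dD; have [c pd] := scal p d pS dD.
    rewrite -[RHS]mulrA pd !mulrA (JMalg_comm _ _ m _ _ dD pD) pd.
    by rewrite -!scalerAl -scalerAr.
  move=> /(scal p _ pS)[c]; rewrite !mulrA pp => phc.
  by exists c.
have [chi {}chiP] := choice chiP.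
have chiV h : h \in Sym_below m -> chi h^-1%g = (chi h)^*.
  move=> hm; have : star (p * e h * p) = p * e h^-1%g * p.
    by rewrite !starM sp star_elt mulrA.
  rewrite !chiP ?groupV // starZ sp => /eqP; rewrite -subr_eq0 -scalerBl.
  by rewrite scaler_eq0 (negPf p0) orbF subr_eq0 => /eqP.
pose w := average m (p * x * p).
have wD : w \in JMalg m.+1.
  apply: (@centralizer_in_JMalg K n q); last exact: average_invariant.
  apply: average_supported => //.
  by do 2?apply: supportedM => //; apply: supportedS pSupp.
have pwp : p * w * p = (\sum_(h in Sym_below m) `|chi h| ^+ 2) *: (p * x * p).
  rewrite mulr_sumr mulr_suml scaler_suml; apply: eq_bigr => h hm.
  have -> : p * (e h^-1%g * (p * x * p) * e h) * p =
            (p * e h^-1%g * p) * x * (p * e h * p) by rewrite !mulrA.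
  rewrite !chiP ?groupV // chiV // -scalerAr -!scalerAl scalerA.
  by rewrite normCK.
have c0 : \sum_(h in Sym_below m) `|chi h| ^+ 2 != 0.
  have chi1 : chi 1%g = 1.
    have := chiP 1%g (group1 _); rewrite ga_elt1 mulr1 pp => /eqP.
    rewrite -{1}(scale1r p) -subr_eq0 -scalerBl scaler_eq0 (negPf p0) orbF.
    by rewrite subr_eq0 => /eqP.
  rewrite (bigD1 1%g) ?group1 //= chi1 normr1 expr1n gt_eqF //.
  by rewrite ltr_pwDl // sumr_ge0 // => h _; rewrite exprn_ge0.
have : p * w * p \in JMalg m.+1 by rewrite !JMalgM // (JMalgS _ _ m).
by rewrite pwp rpredZeq (negPf c0).
Qed.

End MaximalCommutativity.
(** * Embeddings of symmetric groups *)

Section PermPush.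
Variables (m n : nat) (r : {ffun 'I_m -> 'I_n}).
Hypothesis rI : injective r.
Implicit Types (s t : 'S_m) (g : 'S_n).

Lemma perm_push_in s i : perm_push r s (r i) = r (s i).
Proof.
rewrite perm_pushE // ffunE; case: pickP => [j /eqP/rI->//|/(_ i)].
by rewrite eqxx.
Qed.

Lemma perm_push_out s x : x \notin codom r -> perm_push r s x = x.
Proof.
move=> xr; rewrite perm_pushE // ffunE; case: pickP => // i /eqP rix.
by rewrite -rix codom_f in xr.
Qed.

Lemma perm_push_eq s g :
    (forall i, g (r i) = r (s i)) -> (forall x, x \notin codom r -> g x = x) ->
  perm_push r s = g.
Proof.
move=> gin gout; apply/permP => x.
have [/codomP[i ->]|xr] := boolP (x \in codom r).
  by rewrite perm_push_in gin.
by rewrite perm_push_out ?gout.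
Qed.

Lemma perm_pushM s t : perm_push r (s * t)%g = (perm_push r s * perm_push r t)%g.
Proof.
apply: perm_push_eq => [i|x xr]; rewrite !permM; first by rewrite !perm_push_in.
by rewrite !perm_push_out.
Qed.

Lemma perm_push1 : perm_push r 1%g = 1%g.
Proof. by apply: perm_push_eq => [i|x _]; rewrite !perm1. Qed.

Lemma perm_pushV s : perm_push r s^-1%g = (perm_push r s)^-1%g.
Proof. by apply/eqP; rewrite eq_sym eq_invg_mul -perm_pushM mulgV perm_push1. Qed.

Lemma perm_push_inj : injective (perm_push r).
Proof. by move=> s t st; apply/permP => i; apply: rI; rewrite -!perm_push_in st. Qed.

Lemma perm_push_tperm i j : perm_push r (tperm i j) = tperm (r i) (r j).
Proof.
apply: perm_push_eq => [k|x xr].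
  by rewrite (inj_tperm _ _ _ rI).
by rewrite tpermD //; apply: contraNneq xr => <-; exact: codom_f.
Qed.

(** Both signs are morphisms, and the embedding takes transpositions to
transpositions. *)
Lemma odd_perm_push s : perm_push r s = s :> bool.
Proof.
have [ts -> _] := prod_tpermP s.
elim: ts => [|[i j] ts IHts]; first by rewrite big_nil perm_push1 !odd_perm1.
rewrite big_cons perm_pushM !odd_permM {}IHts perm_push_tperm !odd_tperm /=.
by rewrite (inj_eq rI).
Qed.

Lemma perm_push_onto g :
  (forall x, x \notin codom r -> g x = x) -> exists s, perm_push r s = g.
Proof.
move=> gout; have gr i : exists j, r j == g (r i).
  have [/codomP[j ->]|] := boolP (g (r i) \in codom r); first by exists j.
  by move=> /gout/perm_inj gri; exists i; rewrite gri.
have fI : injective (fun i => xchoose (gr i)).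
  move=> i j ij; apply/rI/(@perm_inj _ g).
  by rewrite -(eqP (xchooseP (gr i))) -(eqP (xchooseP (gr j))) ij.
exists (perm fI); apply: perm_push_eq => // i.
by rewrite permE (eqP (xchooseP (gr i))).
Qed.

Lemma ga_push_elt (K : fieldType) s :
  ga_push r (ga_elt K s) = ga_elt K (perm_push r s).
Proof.
rewrite /ga_push (bigD1 s) //= big1 ?addr0 ?ga_eltE ?eqxx ?scale1r //.
by move=> t /negPf ts; rewrite ga_eltE ts scale0r.
Qed.

Lemma ga_pushM (K : fieldType) (x y : group_alg K 'S_m) :
  ga_push r (x * y) = ga_push r x * ga_push r y.
Proof.
rewrite (ga_expand _ _ x) mulr_suml !linear_sum mulr_suml.
apply: eq_bigr => s _; rewrite (ga_expand _ _ y) mulr_sumr !linear_sum mulr_sumr.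
apply: eq_bigr => t _; rewrite -scalerAl -scalerAr !linearZ /= !ga_push_elt.
by rewrite -scalerAl -scalerAr -ga_eltM !ga_push_elt perm_pushM ga_eltM.
Qed.

End PermPush.

(** * The Gelfand-Zetlin algebra *)

Section GelfandZetlinJM.
Variables (K : numFieldType) (n : nat).
Local Notation A := (group_alg K 'S_n).
Local Notation e := (ga_elt K).
Implicit Types (p a b c : 'I_n) (x y : A).

Lemma first_points_inj p : injective (first_points p).
Proof. by move=> i j; rewrite !ffunE => /(congr1 val) ij; apply: val_inj. Qed.

Lemma codom_first_points p a : (a \in codom (first_points p)) = (a <= p)%N.
Proof.
apply/codomP/idP => [[i ->]|ap]; first by rewrite ffunE /= -ltnS.
by exists (Ordinal (ap : (a < p.+1)%N)); rewrite ffunE; apply: val_inj.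
Qed.

Lemma perm_push_first_points p s : perm_push (first_points p) s \in Sym_below n p.+1.
Proof.
apply/Sym_belowP => a pa; apply: perm_push_out; first exact: first_points_inj.
by rewrite codom_first_points -ltnNge.
Qed.

Lemma perm_push_first_points_onto p g :
  g \in Sym_below n p.+1 -> exists s, perm_push (first_points p) s = g.
Proof.
move=> /Sym_belowP gS; apply: perm_push_onto; first exact: first_points_inj.
by move=> a; rewrite codom_first_points -ltnNge; exact: gS.
Qed.

(** Identifies each generating subspace of the Gelfand-Zetlin algebra with an
intrinsic set of elements of the big group algebra. *)
Lemma ga_push_center p x :
  reflect (supported K n p.+1 x /\ invariant K n p.+1 x)
    (x \in (linfun (ga_push (first_points p)) @: 'Z({:group_alg K 'S_p.+1}))%VS).
Proof.
have rI := @first_points_inj p; pose r := first_points p.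
apply: (iffP memv_imgP) => [[y yZ ->]|[xS xI]].
  rewrite lfunE /=; split.
    apply: supported_sum => s _; rewrite -[_ *: _]addr0; apply: supportedD.
      exact/supported_elt/perm_push_first_points.
    by move=> g _; rewrite ga_0E.
  move=> h /perm_push_first_points_onto[s <-].
  move: yZ; rewrite memv_cap => /andP[_ /centvP yC].
  by rewrite -ga_push_elt // -!ga_pushM // yC ?memvf.
pose y : group_alg K 'S_p.+1 := [ffun s => x (perm_push r s)].
have yE s : y s = x (perm_push r s) by rewrite ffunE.
exists y; last first.
  rewrite lfunE /= {1}(ga_expand _ _ x) /ga_push.
  rewrite (bigID (mem (perm_push r @: [set: 'S_p.+1]))) /= addrC big1 ?add0r.
    rewrite big_imset /=; last by move=> s t _ _; exact: perm_push_inj.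
    by apply: eq_big => s; rewrite ?inE // yE.
  move=> g gr; rewrite xS ?scale0r //; apply: contraNN gr.
  by move=> /perm_push_first_points_onto[s <-]; rewrite imset_f ?inE.
rewrite memv_cap memvf; apply/centvP => z _.
rewrite (ga_expand _ _ z) mulr_sumr mulr_suml; apply: eq_bigr => t _.
rewrite -scalerAr -scalerAl; congr (_ *: _).
apply/ga_comm_conj/ffunP => s; rewrite ga_conjE !yE !perm_pushM // perm_pushV //.
have /ga_comm_conj xt := xI _ (perm_push_first_points p t).
by rewrite -[in RHS]xt ga_conjE.
Qed.

(** The sum of the X_c with c <= a is half the sum U of the transpositions (b c),
over ordered pairs, of the first a + 1 points, which is central for their
group; so each X_a is a difference of central elements. *)
Lemma gelfand_zetlin_JMalg : gelfand_zetlin K n = JMalg K n n.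
Proof.
apply/subv_anti/andP; split.
  apply: agenv_sub; apply/subv_sumP => p _; apply/subvP => x.
  move=> /ga_push_center[xS xI]; apply: (JMalgS _ _ _ _ (ltn_ord p)).
  exact: central_in_JMalg.
apply: agenv_sub; apply/subv_sumP => a _; rewrite -memvE.
have [N] := ubnP a; elim: N a => // N IHN a; rewrite ltnS => aN.
pose U := \sum_(c : 'I_n | (c <= a)%N)
  \sum_(b : 'I_n | (b <= a)%N && (b != c)) e (tperm b c) : A.
have UE : U = 2%:R *: \sum_(c : 'I_n | (c <= a)%N) JM K n c.
  rewrite scaler_nat mulr2n.
  have lt_gt c : (c <= a)%N -> \sum_(b : 'I_n | (b <= a)%N && (b != c))
      e (tperm b c) = JM K n c +
      \sum_(b : 'I_n | (b <= a)%N && (c < b)%N) e (tperm b c) :> A.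
    move=> ca; rewrite (bigID (fun b : 'I_n => (b < c)%N)) /=; congr (_ + _).
      apply: eq_bigl => b; have [bc|] := ltnP b c; last by rewrite andbF.
      by rewrite (leq_trans (ltnW bc) ca) neq_ltn bc.
    by apply: eq_bigl => b; rewrite -leqNgt -andbA ltn_neqAle eq_sym.
  rewrite /U (eq_bigr _ lt_gt) big_split /=; congr (_ + _).
  rewrite (exchange_big_dep (fun b : 'I_n => (b <= a)%N)) /=; last first.
    by move=> c b _ /andP[].
  apply: eq_bigr => b ba; apply: eq_big => [c|c _]; last by rewrite tpermC.
  rewrite ba /=; case: (ltnP c b) => [cb|]; last by rewrite andbF.
  by rewrite (leq_trans (ltnW cb)).
have UZ : U \in gelfand_zetlin K n.
  apply: (subvP (sub_agenv _)); apply: (subvP (sumv_sup a isT (subvv _))).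
  apply/ga_push_center; split.
    apply: supported_sum => c ca; apply: supported_sum => b /andP[ba _].
    exact/supported_elt/tperm_Sym_below.
  move=> h hS; apply/ga_comm_conj; rewrite mulr_sumr mulr_suml.
  rewrite [RHS](reindex_inj (@perm_inj _ h)) /=.
  have hle c : (h c <= a)%N = (c <= a)%N.
    by rewrite -[LHS]ltnS (Sym_below_lt _ _ _ _ hS) ltnS.
  apply: eq_big => [c|c _]; first by rewrite hle.
  rewrite mulr_sumr mulr_suml [RHS](reindex_inj (@perm_inj _ h)) /=.
  apply: eq_big => [b|b _]; first by rewrite hle (inj_eq perm_inj).
  by rewrite ga_eltJ tpermJ.
have -> : JM K n a = 2%:R^-1 *: U - \sum_(c : 'I_n | (c < a)%N) JM K n c.
  rewrite UE scalerA mulVf ?pnatr_eq0 // scale1r (bigD1 a) //=.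
  rewrite (eq_bigl (fun c : 'I_n => (c < a)%N)) ?addrK // => c.
  by rewrite ltn_neqAle andbC.
rewrite memvB ?memvZ //; apply: memv_suml => c ca; apply: IHN.
exact: leq_trans ca aN.
Qed.

End GelfandZetlinJM.
(** * Antisymmetrizers on subsets *)

Section IncreasingMaps.
Variables i n : nat.
Implicit Types (r : {ffun 'I_i -> 'I_n}) (I : {set 'I_n}).

Lemma increasingP r :
  reflect (forall a b : 'I_i, (a < b)%N -> (r a < r b)%N) (increasing r).
Proof.
apply: (iffP forallP) => [rlt a b ab|rlt a].
  by have /forallP/(_ b)/implyP/(_ ab) := rlt a.
by apply/forallP => b; apply/implyP; exact: rlt.
Qed.

Lemma increasing_inj r : increasing r -> injective r.
Proof.
move=> /increasingP rlt a b rab; apply: val_inj.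
by have [/rlt|/rlt|//] := ltngtP a b; rewrite rab ltnn.
Qed.

Lemma enum_set_sorted I : sorted ltn [seq val a | a <- enum I].
Proof.
rewrite sorted_map /enum_mem; apply: sorted_filter.
  by move=> b a c; exact: ltn_trans.
by rewrite -sorted_map -enumT val_enum_ord iota_ltn_sorted.
Qed.

(** Both lists are strictly increasing and have the same elements. *)
Lemma codom_increasing r : increasing r ->
  codom r = enum [set a in codom r].
Proof.
move=> rinc; have rI := increasing_inj r rinc; have /increasingP rlt := rinc.
apply: (inj_map val_inj).
apply: (irr_sorted_eq ltn_trans ltnn); last first.
- move=> x; apply/mapP/mapP => -[a aI ->]; exists a => //.
    by rewrite mem_enum inE.
  by move: aI; rewrite mem_enum inE.
- exact: enum_set_sorted.
rewrite /codom /image_mem -map_comp sorted_map.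
have: sorted ltn [seq val a | a <- enum 'I_i] by rewrite val_enum_ord iota_ltn_sorted.
by rewrite sorted_map; apply: sub_sorted => a b; exact: rlt.
Qed.

(** Lets the sum that defines Phi range over sets, on which transpositions act
more conveniently than on increasing maps. *)
Lemma sum_increasing (V : zmodType) (F : {set 'I_n} -> V) :
  \sum_(r : {ffun 'I_i -> 'I_n} | increasing r) F [set a in codom r] =
  \sum_(I : {set 'I_n} | #|I| == i) F I.
Proof.
pose c r := [set a in codom r].
have cinj : {in [pred r | increasing r] &, injective c}.
  move=> r1 r2; rewrite !inE => r1i r2i rr; apply/ffunP => a.
  have : codom r1 = codom r2 by rewrite (codom_increasing r1) // (codom_increasing r2) // -/(c r1) rr.
  by move=> /eq_in_map -> //; rewrite mem_enum.
rewrite -(big_imset (h := c) F cinj) /=; apply: eq_bigl => I.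
apply/imsetP/eqP => [[r ri ->]|cI].
  by rewrite cardsE card_codom ?card_ord //; exact: increasing_inj.
pose r := [ffun a : 'I_i => enum_val (cast_ord (esym cI) a)].
exists r.
  apply/increasingP => a b ab; rewrite !ffunE.
  pose x0 := enum_val (cast_ord (esym cI) a).
  rewrite !(enum_val_nth x0) /= -!(nth_map x0 0%N val) -?cardE ?cI //.
  by rewrite (sorted_ltn_nth ltn_trans) ?enum_set_sorted // inE size_map -cardE cI.
apply/setP => x; rewrite inE; apply/idP/codomP => [xI|[a ->]]; last first.
  by rewrite ffunE enum_valP.
exists (cast_ord cI (enum_rank_in xI x)).
by rewrite ffunE cast_ordK enum_rankK_in.
Qed.

End IncreasingMaps.

Section Antisymmetrizers.
Variables (K : numFieldType) (n : nat).
Local Notation A := (group_alg K 'S_n).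
Local Notation e := (ga_elt K).
Implicit Types (I J : {set 'I_n}) (a b c : 'I_n) (g s : 'S_n).

Definition asym I : A := \sum_(s : 'S_n | perm_on I s) (-1) ^+ s *: e s.

Lemma asym_push i (r : {ffun 'I_i -> 'I_n}) : injective r ->
  i`!%:R *: ga_push r (antisymmetrizer K i) = asym [set a in codom r].
Proof.
move=> rI; rewrite /antisymmetrizer linearZ /= scalerA mulfV; last first.
  by rewrite pnatr_eq0 -lt0n fact_gt0.
rewrite scale1r linear_sum /= /asym.
under eq_bigr => s _ do rewrite linearZ /= ga_push_elt // -(odd_perm_push _ _ _ rI s).
rewrite -(big_imset (h := perm_push r)
  (fun g : 'S_n => (-1) ^+ g *: e g : A)) /=; last first.
  by move=> s t _ _; exact: perm_push_inj.
apply: eq_bigl => g; apply/imsetP/fintype.subsetP => [[s _ ->] a|gI].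
  rewrite !inE; apply: contraNT => ar; apply/eqP; exact: perm_push_out.
have [|s gE] := @perm_push_onto _ _ _ rI g; last by exists s.
by move=> a ar; apply/eqP; apply: contraNT ar => /gI; rewrite inE.
Qed.

Lemma asym_conj I g : e g^-1%g * asym I * e g = asym (g @: I).
Proof.
rewrite /asym mulr_sumr mulr_suml [RHS](reindex_inj (conjg_inj g)) /=.
apply: eq_big => [s|s _]; last first.
  by rewrite -scalerAr -scalerAl ga_eltJ odd_permJ.
apply/fintype.subsetP/fintype.subsetP => sI a.
  rewrite !inE -[a](permKV g) permJ (inj_eq perm_inj) => sa.
  by rewrite imset_f ?sI ?inE.
rewrite inE => sa; rewrite -(mem_imset _ _ (@perm_inj _ g)) sI // inE permJ.
by rewrite (inj_eq perm_inj).
Qed.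

Lemma mem_tperm_imset I a b c : (c \in tperm a b @: I) = (tperm a b c \in I).
Proof. by rewrite -{1}(tpermK a b c) mem_imset //; exact: perm_inj. Qed.

Lemma asym_fix I a b : a \notin I -> b \notin I ->
  e (tperm a b) * asym I = asym I * e (tperm a b).
Proof.
move=> aI bI; apply/esym/ga_comm_conj; rewrite asym_conj; congr asym.
apply/setP => c; rewrite mem_tperm_imset.
by case: tpermP => [->|->|]; rewrite ?(negPf aI) ?(negPf bI).
Qed.

Lemma asym_mem I a b : a \in I -> b \in I -> a != b ->
  e (tperm a b) * asym I = asym I * e (tperm a b).
Proof.
move=> aI bI ab; apply/esym/ga_comm_conj; rewrite asym_conj; congr asym.
apply/setP => c; rewrite mem_tperm_imset.
by case: tpermP => [->|->|]; rewrite ?aI ?bI.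
Qed.

(** These two rules turn every bracket of (a b) with an antisymmetrizer into one
for a set that contains only one of a and b. *)
Lemma asym_tperml I a b :
  e (tperm a b) * asym (tperm a b @: I) = asym I * e (tperm a b).
Proof. by rewrite -asym_conj tpermV !mulrA -ga_eltM tperm2 mul1r. Qed.

Lemma asym_tpermr I a b :
  asym (tperm a b @: I) * e (tperm a b) = e (tperm a b) * asym I.
Proof. by rewrite -asym_conj tpermV -[LHS]mulrA -ga_eltM tperm2 mulr1. Qed.

(** The permutations of J fix a and so permute the transpositions (a b), b in
J. *)
Lemma asym_star_comm J a : a \notin J ->
  (\sum_(b in J) e (tperm a b)) * asym J = asym J * (\sum_(b in J) e (tperm a b)).
Proof.
move=> aJ; rewrite mulr_sumr mulr_suml; apply: eq_bigr => s sJ.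
rewrite -scalerAr -scalerAl; congr (_ *: _); apply/ga_comm_conj.
rewrite mulr_sumr mulr_suml [RHS](reindex_inj (@perm_inj _ s)) /=.
apply: eq_big => [b|b _]; first by rewrite (perm_closed _ sJ).
by rewrite ga_eltJ tpermJ (out_perm sJ aJ).
Qed.

Lemma perm_on2 a b s : a != b ->
  perm_on [set a; b] s = (s == 1%g) || (s == tperm a b).
Proof.
move=> ab; apply/idP/orP => [sab|[]/eqP->]; last 2 first.
- by apply/fintype.subsetP => c; rewrite inE perm1 eqxx.
- by apply/fintype.subsetP => c; rewrite !inE; case: tpermP => [->|->|_ _]; rewrite eqxx ?orbT.
have sbE : s b \in [set a; b] by rewrite perm_closed // set22.
have : s a \in [set a; b] by rewrite perm_closed // set21.
rewrite !inE => /orP[]/eqP sa; [left|right]; apply/eqP/permP => c.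
- rewrite perm1; have [/set2P[->//|->]|cab] := boolP (c \in [set a; b]).
    move: sbE => /set2P[|//] sb; case/eqP: ab; apply: (@perm_inj _ s).
    by rewrite sa sb.
  by rewrite (out_perm sab cab).
- case: tpermP => [->//|->|/eqP ca /eqP cb].
    by move: sbE => /set2P[//|] sb; case/eqP: ab; apply: (@perm_inj _ s); rewrite sa sb.
  by rewrite (out_perm sab) // !inE negb_or ca.
Qed.

Lemma asym2 a b : a != b -> asym [set a; b] = 1 - e (tperm a b).
Proof.
move=> ab; rewrite /asym (eq_bigl _ _ (fun s => perm_on2 a b s ab)).
have t1 : tperm a b != 1%g.
  by apply: contraNneq ab => /permP/(_ a); rewrite tpermL perm1 => ->.
rewrite (bigD1 1%g) ?eqxx //= (bigD1 (tperm a b)) ?eqxx ?orbT //= big1 ?addr0.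
  by rewrite odd_perm1 odd_tperm ab expr0 expr1 scale1r scaleN1r.
by move=> s /andP[/andP[/orP[]/eqP->]]; rewrite ?eqxx ?andbF.
Qed.

End Antisymmetrizers.

(** * Gaudin Hamiltonians and the Bethe algebra *)

Section BetheCommutes.
Variables (K : numFieldType) (n : nat) (z : 'I_n -> K).
Local Notation A := (group_alg K 'S_n).
Local Notation e := (ga_elt K).
Local Notation asym := (asym K n).
Implicit Types (I J : {set 'I_n}) (a b c : 'I_n).

Definition outer_poly I : {poly K} := \prod_(c | c \notin I) ('X - (z c)%:P).

Lemma outer_poly_insert I b : b \notin I ->
  outer_poly I = ('X - (z b)%:P) * outer_poly (b |: I).
Proof.
move=> bI; rewrite /outer_poly (bigD1 b) //=; congr (_ * _).
by apply: eq_bigl => c; rewrite !inE negb_or andbC.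
Qed.

Lemma size_outer_poly I : size (outer_poly I) = (n - #|I|).+1.
Proof.
rewrite /outer_poly (eq_bigl (mem (~: I))) => [|c]; last by rewrite !inE.
rewrite -big_enum size_prod_XsubC -cardE; congr _.+1.
by rewrite cardsCs finset.setCK card_ord.
Qed.

Lemma Phi_sets i :
  Phi z i = \sum_(I : {set 'I_n} | #|I| == i)
    (asym I)%:P * map_poly (in_alg A) (outer_poly I).
Proof.
rewrite -(sum_increasing i n _ (fun I => (asym I)%:P * map_poly (in_alg A) (outer_poly I))).
apply: eq_bigr => r rinc; rewrite asym_push; last exact: increasing_inj.
by congr (_ * map_poly _ _); apply: eq_bigl => b; rewrite inE.
Qed.

Lemma coef_Phi i m :
  (Phi z i)`_m = \sum_(I : {set 'I_n} | #|I| == i) (outer_poly I)`_m *: asym I.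
Proof.
rewrite Phi_sets coef_sum; apply: eq_bigr => I _.
by rewrite coefCM coef_map /= -scalerAr mulr1.
Qed.

Definition gap a b := \prod_(c | (c != a) && (c != b)) (z a - z c).

(** Up to the sign and a multiple of 1, this is the residue at z_a of
Phi_2(u) / prod_c (u - z_c), times the product of the z_a - z_c over c <> a; in
this form it makes sense for coinciding parameters as well. *)
Definition hamiltonian a : A := \sum_(b | b != a) gap a b *: e (tperm a b).

Lemma bethe_coef i m : (0 < i)%N -> (i <= n)%N -> (m <= n - i)%N ->
  (Phi z i)`_m \in bethe z.
Proof.
move=> i0 ni mi; apply: (subvP (sub_agenv _)); rewrite memvE.
rewrite (big_cat_nat _ (n := i)) //=; last exact: ltnW.
rewrite (subv_trans _ (addvSr _ _)) // big_ltn ?ltnS //.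
rewrite (subv_trans _ (addvSl _ _)) //.
rewrite (big_cat_nat _ (n := (n - i - m)%N)) //=; last first.
  by rewrite leqW // leq_subr.
rewrite (subv_trans _ (addvSr _ _)) // big_ltn; last by rewrite ltnS leq_subr.
by rewrite (subv_trans _ (addvSl _ _)) // /Phi_coef subKn.
Qed.

(** The sum is the value of Phi_2 at z_a. *)
Lemma horner_Phi2_in_bethe a : (1 < n)%N ->
  \sum_(I : {set 'I_n} | #|I| == 2) (outer_poly I).[z a] *: asym I \in bethe z.
Proof.
move=> n1.
have -> : \sum_(I : {set 'I_n} | #|I| == 2) (outer_poly I).[z a] *: asym I =
    \sum_(m < (n - 2).+1) z a ^+ m *: (Phi z 2)`_m.
  under [RHS]eq_bigr => m _ do rewrite coef_Phi scaler_sumr.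
  rewrite [RHS]exchange_big /=; apply: eq_bigr => I /eqP I2.
  rewrite horner_coef size_outer_poly I2 scaler_suml; apply: eq_bigr => m _.
  by rewrite scalerA mulrC.
apply: memv_suml => m _; rewrite memvZ // bethe_coef //.
by rewrite -ltnS.
Qed.

Lemma sum_pairs (V : zmodType) (F : {set 'I_n} -> V) a :
  \sum_(I : {set 'I_n} | (#|I| == 2) && (a \in I)) F I =
  \sum_(b | b != a) F [set a; b].
Proof.
rewrite (reindex_onto (fun b => [set a; b])
  (fun I => odflt a [pick b in I :\ a])) /=; last first.
  move=> I /andP[/eqP I2 aI].
  have /eqP/cards1P[b Ib] : #|I :\ a| = 1.
    by have := cardsD1 a I; rewrite I2 aI => -[/esym].
  rewrite Ib; case: pickP => [c|/(_ b)]; rewrite inE ?eqxx // => /eqP-> /=.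
  by rewrite -Ib finset.setD1K.
apply: eq_bigl => b; rewrite set21 andbT cards2 eqSS eqb1.
have [->//|ab] := eqVneq b a; rewrite /=; case: pickP => [c|/(_ b)]; rewrite !inE ?ab ?eqxx ?orbT //.
by move=> /andP[/negPf-> /= /eqP->]; rewrite eqxx.
Qed.

(** At u = z_a only the sets {a, b} contribute to Phi_2(u), and their
antisymmetrizers are 1 - (a b). *)
Lemma hamiltonian_in_bethe a : hamiltonian a \in bethe z.
Proof.
have [n1|n1] := ltnP 1 n; last first.
  rewrite /hamiltonian big1 ?mem0v // => b ba; case/eqP: ba; apply: val_inj.
  have val0 (c : 'I_n) : val c = 0%N.
    by apply/eqP; rewrite -leqn0 -ltnS (leq_trans (ltn_ord c)).
  by rewrite !val0.
have := horner_Phi2_in_bethe a n1.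
rewrite (bigID (fun I : {set 'I_n} => a \in I)) /= sum_pairs.
rewrite [X in _ + X]big1 ?addr0; last first.
  move=> I /andP[_ aI]; rewrite (outer_poly_insert I a) //.
  by rewrite !hornerE subrr mul0r scale0r.
under eq_bigr => b ba.
  rewrite asym2; last by rewrite eq_sym.
  rewrite scalerBr; have -> : (outer_poly [set a; b]).[z a] = gap a b.
    rewrite /outer_poly horner_prod; apply: eq_big => [c|c _].
      by rewrite !inE negb_or.
    by rewrite !hornerE.
  over.
rewrite sumrB => HB.
rewrite -[hamiltonian a](subKr (\sum_(b | b != a) gap a b *: 1)).
rewrite memvB // -scaler_suml memvZ //; exact: memv_agenv1.
Qed.

Let br a b I : A := e (tperm a b) * asym I - asym I * e (tperm a b).

(** Only the sets I with exactly one of a and b in them contribute to the bracket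
with (a b), and the brackets for I and its image under (a b) are opposite.
Combining the two takes a factor z_a - z_b out of the polynomials and leaves
that of I + b; this factor completes the weight of (a b) to a product that
depends only on a.  Regrouped by J = I + b, the remaining sum over b of the
brackets is that of the antisymmetrizer of J - a with the sum of the (a b),
which vanishes by [asym_star_comm]. *)
Lemma hamiltonian_comm_coef a i m :
  hamiltonian a * (Phi z i)`_m = (Phi z i)`_m * hamiltonian a.
Proof.
pose w I := (outer_poly I)`_m.
have wE I b : b \notin I -> a \in I ->
    w I - w (tperm a b @: I) = (z a - z b) * w (b |: I).
  move=> bI aI; have ba : a != b by apply: contraNneq bI => <-.
  have aI' : a \notin tperm a b @: I.
    by rewrite mem_tperm_imset tpermL.
  have tI : a |: tperm a b @: I = b |: I.
    apply/setP => c; rewrite !inE mem_tperm_imset.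
    by case: tpermP => [->|->|/eqP/negPf-> /eqP/negPf->]; rewrite ?aI ?eqxx ?orbT //.
  rewrite /w -coefB (outer_poly_insert _ _ bI) (outer_poly_insert _ _ aI') tI.
  rewrite -mulrBl; have -> : 'X - (z b)%:P - ('X - (z a)%:P) = (z a - z b)%:P.
    by rewrite polyCB opprB addrC addrA subrK.
  by rewrite coefCM.
have brS b I : br a b (tperm a b @: I) = - br a b I.
  by rewrite /br asym_tperml asym_tpermr opprB.
have pairing b : b != a ->
    \sum_(I : {set 'I_n} | #|I| == i) w I *: br a b I = (z a - z b) *:
    \sum_(J : {set 'I_n} | [&& #|J| == i.+1, a \in J & b \in J])
      w J *: br a b (J :\ b).
  move=> ba; pose P I := [&& #|I| == i, a \in I & b \notin I].
  transitivity (\sum_(I | P I) (w I *: br a b I - w (tperm a b @: I) *: br a b I)).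
    rewrite (bigID (fun I : {set 'I_n} => (a \in I) && (b \notin I))) /=.
    rewrite big_split /=; congr (_ + _).
    rewrite (bigID (fun I : {set 'I_n} => (a \notin I) && (b \in I))) /=.
    rewrite [X in _ + X]big1 ?addr0; last first.
      move=> I /andP[/andP[_ nab] nba]; rewrite /br.
      suff -> : e (tperm a b) * asym I = asym I * e (tperm a b) by rewrite subrr scaler0.
      move: nab nba; have [aI|aI] := boolP (a \in I); have [bI|bI] := boolP (b \in I) => //= _ _.
        by rewrite asym_mem // eq_sym.
      by rewrite asym_fix.
    rewrite (reindex_inj (imset_inj (@perm_inj _ (tperm a b)))) /=.
    apply: eq_big => [I|I _]; last by rewrite brS scalerN.
    rewrite card_imset; last exact: perm_inj.
    rewrite !mem_tperm_imset tpermL tpermR.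
    rewrite /P; case: (a \in I) (b \in I) => [] []; rewrite ?andbF ?andbT //=.
  rewrite scaler_sumr; under eq_bigr => I /and3P[_ aI bI].
    rewrite -scalerBl wE // -scalerA; over.
  rewrite [RHS](reindex_onto (fun I => b |: I) (fun J => J :\ b)) /=; last first.
    by move=> J /and3P[_ _ bJ]; rewrite finset.setD1K.
  apply: eq_big => [I|I /and3P[_ aI bI]]; last by rewrite finset.setU1K.
  rewrite /P !inE eqxx /= andbT; have [bI|bI] := boolP (b \in I).
    rewrite !andbF; apply/esym/negP => /andP[_ /eqP IE].
    by move: bI; rewrite -IE setD11.
  by rewrite finset.setU1K // eqxx !andbT cardsU1 bI [a == b]eq_sym (negPf ba) orFb add1n eqSS.
have star_bracket J : a \in J -> \sum_(b | (b != a) && (b \in J)) br a b (J :\ b) = 0.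
  move=> aJ; pose J' := J :\ a.
  have -> : \sum_(b | (b != a) && (b \in J)) br a b (J :\ b) =
     \sum_(b in J') (asym J' * e (tperm a b) - e (tperm a b) * asym J').
    apply: eq_big => [b|b /andP[ba bJ]]; first by rewrite !inE.
    have -> : J :\ b = tperm a b @: J'.
      apply/setP => c; rewrite mem_tperm_imset !inE; case: tpermP => [->|->|/eqP/negPf-> /eqP/negPf->] //.
        by rewrite aJ ba bJ eq_sym ba.
      by rewrite !eqxx.
    by rewrite /br asym_tperml asym_tpermr.
  rewrite sumrB -mulr_sumr -mulr_suml asym_star_comm ?subrr //.
  by rewrite !inE eqxx.
apply/eqP; rewrite -subr_eq0 coef_Phi; apply/eqP.
transitivity (\sum_(b | b != a) gap a b *:
    \sum_(I : {set 'I_n} | #|I| == i) w I *: br a b I).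
  rewrite mulr_sumr mulr_suml -sumrB.
  under [RHS]eq_bigr => b _ do rewrite scaler_sumr.
  rewrite [RHS]exchange_big /=; apply: eq_bigr => I _.
  rewrite -scalerAr -scalerAl -scalerBr mulr_suml mulr_sumr -sumrB scaler_sumr.
  apply: eq_bigr => b _; rewrite -scalerAr -scalerAl -scalerBr !scalerA mulrC //.
pose Q := \prod_(c | c != a) (z a - z c).
have gapQ b : b != a -> gap a b * (z a - z b) = Q.
  by move=> ba; rewrite /Q (bigD1 b) //= mulrC.
under eq_bigr => b ba do rewrite pairing // scalerA gapQ //.
rewrite -scaler_sumr (exchange_big_dep (fun J : {set 'I_n} => a \in J)) /=.
  rewrite big1 ?scaler0 // => J aJ.
  have [Ji|Ji] := boolP (#|J| == i.+1); last by rewrite big_pred0 // => b; rewrite andbF.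
  rewrite -scaler_sumr -[X in _ *: X](_ : 0 = _) ?scaler0 //.
  by rewrite -[LHS](star_bracket J aJ); apply: eq_bigl => b; rewrite aJ.
by move=> b J _ /and3P[].
Qed.

Lemma hamiltonian_comm_bethe a x : x \in bethe z ->
  x * hamiltonian a = hamiltonian a * x.
Proof.
move: x; apply: agenv_comm => x xU; apply/cent1vP; move: x xU; apply/subvP.
elim/big_ind: _ => [|U V|i _]; first exact: sub0v.
  by rewrite subv_add => -> ->.
elim/big_ind: _ => [|U V|j _]; first exact: sub0v.
  by rewrite subv_add => -> ->.
by rewrite -memvE; apply/cent1vP; rewrite hamiltonian_comm_coef.
Qed.

End BetheCommutes.
(** * Convergence of scalars, vectors and subspaces *)

Local Open Scope classical_set_scope.

Section Tends.
Variable K : numFieldType.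
Implicit Types (u v : nat -> K) (l m : K).

Definition tends u l : Prop := u k @[k --> \oo] --> l.

Lemma tends_cst l : tends (fun=> l) l.
Proof. exact: cvg_cst. Qed.

Lemma tends_eq u v l : u =1 v -> tends v l -> tends u l.
Proof. by move=> /funext->. Qed.

Lemma tendsD u v l m : tends u l -> tends v m -> tends (fun k => u k + v k) (l + m).
Proof. by move=> ul vm; exact: cvgD. Qed.

Lemma tendsN u l : tends u l -> tends (fun k => - u k) (- l).
Proof. by move=> ul; exact: cvgN. Qed.

Lemma tendsM u v l m : tends u l -> tends v m -> tends (fun k => u k * v k) (l * m).
Proof. by move=> ul vm; exact: cvgM. Qed.

Lemma tendsV u l : l != 0 -> tends u l -> tends (fun k => (u k)^-1) l^-1.
Proof. by move=> l0 ul; exact: cvgV. Qed.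

Lemma tends_near u v l :
  (\forall k \near \oo, u k = v k) -> tends v l -> tends u l.
Proof.
move=> uv vl; apply: cvg_trans vl; apply: near_eq_cvg.
by apply: filterS uv => k ->.
Qed.

Lemma tends_neq0 u l : l != 0 -> tends u l -> \forall k \near \oo, u k != 0.
Proof. by move=> l0 ul; exact: (@cvgr_neq0 K K^o _ _ _ u l ul l0). Qed.

Lemma tends_sum (I : Type) (r : seq I) (P : pred I) (F : I -> nat -> K) (l : I -> K) :
  (forall i, P i -> tends (F i) (l i)) ->
  tends (fun k => \sum_(i <- r | P i) F i k) (\sum_(i <- r | P i) l i).
Proof.
move=> Fl; elim: r => [|i r IHr].
  by rewrite big_nil; apply: tends_eq => [k|]; [by rewrite big_nil|exact (tends_cst _)].
rewrite big_cons; apply: tends_eq => [k|]; first by rewrite big_cons.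
by case: ifP => // Pi; apply: tendsD => //; exact: Fl.
Qed.

Lemma tends_prod (I : Type) (r : seq I) (P : pred I) (F : I -> nat -> K) (l : I -> K) :
  (forall i, P i -> tends (F i) (l i)) ->
  tends (fun k => \prod_(i <- r | P i) F i k) (\prod_(i <- r | P i) l i).
Proof.
move=> Fl; elim: r => [|i r IHr].
  by rewrite big_nil; apply: tends_eq => [k|]; [by rewrite big_nil|exact (tends_cst _)].
rewrite big_cons; apply: tends_eq => [k|]; first by rewrite big_cons.
by case: ifP => // Pi; apply: tendsM => //; exact: Fl.
Qed.

Lemma tends_det d (M_ : nat -> 'M[K]_d) (M : 'M[K]_d) :
  (forall i j, tends (fun k => M_ k i j) (M i j)) ->
  tends (fun k => \det (M_ k)) (\det M).
Proof.
move=> MM; apply: tends_sum => s _; apply: tendsM; first exact: tends_cst.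
by apply: tends_prod => i _.
Qed.

(** With C a right inverse of F, the determinant of F_k C tends to det 1 = 1. *)
Lemma near_row_free d n (F_ : nat -> 'M[K]_(d, n)) (F : 'M[K]_(d, n)) :
    (forall i j, tends (fun k => F_ k i j) (F i j)) -> row_free F ->
  \forall k \near \oo, row_free (F_ k).
Proof.
move=> FF /row_freeP[C FC].
have : tends (fun k => \det (F_ k *m C)) (\det (F *m C)).
  apply: tends_det => i j.
  rewrite [X in tends _ X]mxE; apply: tends_eq => [k|]; first by rewrite mxE.
  by apply: tends_sum => l _; apply: tendsM => //; exact: tends_cst.
rewrite FC det1 => /tends_neq0-/(_ (oner_neq0 _)).
apply: filterS => k; rewrite -unitfE -unitmxE => FCu.
by apply/row_freeP; exists (C *m invmx (F_ k *m C)); rewrite mulmxA mulmxV.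
Qed.

End Tends.

Section VectorTends.
Variables (K : numFieldType) (V : vectType K).
Import VectorInternalTheory.

(** Convergence in the coordinates that define frames of the Grassmannian. *)
Definition vtends (v_ : nat -> V) (v : V) : Prop :=
  forall j, tends K (fun k => v2r (v_ k) 0 j) (v2r v 0 j).

Definition frame_tuple d (F : 'M[K]_(d, dim V)) : d.-tuple V :=
  [tuple r2v (row i F) | i < d].

Definition tuple_frame d (v : 'I_d -> V) : 'M[K]_(d, dim V) :=
  \matrix_(i, j) v2r (v i) 0 j.

Lemma frame_tuple_mx d (v : 'I_d -> V) : frame_tuple d (tuple_frame d v) = [tuple v i | i < d].
Proof.
apply: eq_from_tnth => i; rewrite !tnth_mktuple; apply: (canLR v2rK).
by apply/rowP => j; rewrite !mxE.
Qed.

Lemma frame_spanE d (F : 'M[K]_(d, dim V)) :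
  frame_span F = <<frame_tuple d F>>%VS.
Proof. by rewrite /frame_span /image_mem -val_ord_tuple. Qed.

Lemma free_frame d (F : 'M[K]_(d, dim V)) : free (frame_tuple d F) = row_free F.
Proof.
have sumE (c : 'I_d -> K) :
    \sum_(i < d) c i *: (frame_tuple d F)`_i = r2v (\row_i c i *m F).
  rewrite mulmx_sum_row linear_sum; apply: eq_bigr => i _.
  by rewrite -tnth_nth tnth_mktuple linearZ mxE.
apply/freeP/idP => [Ff|/row_free_inj Ff c].
  rewrite -kermx_eq0; apply/eqP/row_matrixP => i; rewrite row0.
  apply/rowP => j; rewrite [RHS]mxE.
  apply: (Ff (fun j => row i (kermx F) 0 j)); rewrite sumE.
  rewrite (_ : \row_j _ = row i (kermx F)); last by apply/rowP => k; rewrite mxE.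
  by rewrite -row_mul mulmx_ker row0 linear0.
rewrite sumE -(linear0 r2v) => /(can_inj r2vK); rewrite -(mul0mx _ F) => /Ff/rowP c0 i.
by have := c0 i; rewrite !mxE.
Qed.

Lemma near_free d (v_ : nat -> 'I_d -> V) (v : 'I_d -> V) :
    (forall i, vtends (fun k => v_ k i) (v i)) -> free [tuple v i | i < d] ->
  \forall k \near \oo, free [tuple v_ k i | i < d].
Proof.
move=> vv; rewrite -frame_tuple_mx free_frame => vf.
have /near_row_free/(_ vf) : forall i j,
    tends K (fun k => tuple_frame d (v_ k) i j) (tuple_frame d v i j).
  move=> i j; rewrite [X in tends _ _ X]mxE.
  by apply: tends_eq => [k|]; [by rewrite mxE|exact: vv].
by apply: filterS => k; rewrite -free_frame frame_tuple_mx.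
Qed.

(** T is injective on a complement W of its kernel, and the images under T_k of a
basis of W stay free for large k. *)
Lemma near_dim_lker (T_ : nat -> 'End(V)) (T : 'End(V)) :
    (forall v, vtends (fun k => T_ k v) (T v)) ->
  \forall k \near \oo, (\dim (lker (T_ k)) <= \dim (lker T))%N.
Proof.
move=> TT; pose W := (lker T)^C%VS; pose w := vbasis W.
have dimW : (\dim (lker T) + \dim W = \dim {:V})%N.
  by rewrite /W dimv_compl; apply: subnKC; apply: dimvS; exact: subvf.
have wf : free [tuple T w`_i | i < \dim W].
  apply/freeP => c; under eq_bigr => i _ do rewrite -tnth_nth tnth_mktuple -linearZ.
  rewrite -linear_sum => /eqP; rewrite -memv_ker => cker.
  have /freeP := basis_free (vbasisP W); apply.
  apply/eqP; rewrite -memv0 -(capv_compl (lker T)) memv_cap cker.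
  by apply: memv_suml => i _; rewrite memvZ // vbasis_mem // mem_nth // size_tuple.
have /near_free/(_ wf) := fun i : 'I_(\dim W) => TT w`_i.
apply: filterS => k; rewrite /free size_tuple => /eqP wk.
rewrite -(leq_add2r (\dim W)) dimW -(limg_ker_dim (T_ k) fullv).
rewrite capfv leq_add2l -wk dimvS //; apply/span_subvP => _ /tnthP[i ->].
by rewrite tnth_mktuple memv_img ?memvf.
Qed.

(** Approximations of a basis of G within B_k form a frame that tends to one of G;
it is eventually free, and spans B_k for reasons of dimension. *)
Lemma grassmannian_tends (B_ : nat -> {vspace V}) (G : {vspace V}) :
    (forall x, x \in G -> exists x_, (forall k, x_ k \in B_ k) /\ vtends x_ x) ->
    (\forall k \near \oo, (\dim (B_ k) <= \dim G)%N) ->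
  (\forall k \near \oo, \dim (B_ k) = \dim G) /\
  ((B_ k : grassmannian V) @[k --> \oo] --> (G : grassmannian V)).
Proof.
move=> approx dimB; pose d := \dim G; pose b i := (vbasis G)`_i.
have /choice[s sP] : forall i : nat, exists si : nat -> V,
    (forall k, si k \in B_ k) /\ vtends si (b i).
  move=> i; apply: approx.
  have [ib|bi] := ltnP i (size (vbasis G)); first by rewrite vbasis_mem ?mem_nth.
  by rewrite /b nth_default // mem0v.
pose F : 'M[K]_(d, dim V) := tuple_frame d b.
pose F_ k : 'M[K]_(d, dim V) := tuple_frame d (fun i : 'I_d => s i k).
have bE : [tuple b i | i < d] = vbasis G.
  by apply: eq_from_tnth => i; rewrite tnth_mktuple [RHS](tnth_nth 0).
have Ffree : row_free F.
  by rewrite -free_frame frame_tuple_mx bE (basis_free (vbasisP G)).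
have FG : frame_span F = G.
  by rewrite frame_spanE frame_tuple_mx bE; apply: span_basis; exact: vbasisP.
have F_F i j : tends K (fun k => F_ k i j) (F i j).
  rewrite [X in tends _ _ X]mxE.
  by apply: tends_eq => [k|]; [by rewrite mxE|exact: (sP i).2].
have F_free := near_row_free _ _ _ _ _ F_F Ffree.
have F_B : \forall k \near \oo, row_free (F_ k) /\ frame_span (F_ k) = B_ k.
  apply: filterS2 F_free dimB => k Fk dk; split=> //.
  apply/eqP; rewrite eqEdim frame_spanE frame_tuple_mx; apply/andP; split.
    by apply/span_subvP => _ /tnthP[i ->]; rewrite tnth_mktuple (sP i).1.
  have : free [tuple s i k | i < d] by rewrite -frame_tuple_mx free_frame.
  by rewrite /free size_tuple => /eqP->.
split.
  apply: filterS F_B => k [Fk <-]; rewrite frame_spanE.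
  by have := Fk; rewrite -free_frame /free size_tuple => /eqP->.
move=> U; rewrite nbhsE => -[W [oW WG] WU].
have WF : W (frame_span F) by rewrite FG.
have [P PF PW] := oW d F Ffree WF.
have F_P : \forall k \near \oo, forall i j, P i j (F_ k i j).
  apply: filter_forall => i; apply: filter_forall => j.
  exact: (F_F i j _ (PF i j)).
apply: filterS2 F_P F_B => k Pk [Fk FB].
by apply: WU; rewrite -FB; apply: PW.
Qed.

End VectorTends.
(** * Ratios of products of gaps *)

Section GapLimits.
Variables (K : numFieldType) (n : nat) (z : nat -> 'I_n -> K).
Hypothesis (hne : forall (b c : 'I_n) (k : nat),
  (0 < b)%N -> c = b.+1 :> nat -> z k b - z k c != 0).
Hypothesis (hlim : forall a b c : 'I_n, b = a.+1 :> nat -> c = b.+1 :> nat ->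
  tends K (fun k => (z k a - z k b) / (z k b - z k c)) 0).
Local Notation tends := (tends K).
Implicit Types a b c d : 'I_n.

Lemma pred_ordP a : (0 < a)%N -> exists a' : 'I_n, a = a'.+1 :> nat.
Proof.
move=> a0; exists (Ordinal (leq_ltn_trans (leq_pred a) (ltn_ord a))) => /=.
by rewrite prednK.
Qed.

(** Telescoping product of the ratios of consecutive gaps.  Those in the middle are
nonzero since only the first gap z_0 - z_1 may vanish. *)
Lemma step_ratio a b c d : b = a.+1 :> nat -> d = c.+1 :> nat -> (a < c)%N ->
  tends (fun k => (z k a - z k b) / (z k c - z k d)) 0.
Proof.
move=> ba; have [N] := ubnP c; elim: N c d => // N IHN c d cN dc.
rewrite leq_eqVlt => /orP[/eqP ac|ac].
  have -> : c = b by apply: val_inj; rewrite /= ba ac.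
  by apply: hlim => //; rewrite dc -ac ba.
have [c' cc'] := pred_ordP c (leq_ltn_trans (leq0n _) ac).
have ac' : (a < c')%N by rewrite cc' ltnS in ac.
have /IHN/(_ cc' ac') : (c' < N)%N by rewrite -ltnS -cc'.
move=> /tendsM/(_ (hlim _ _ _ cc' dc)); rewrite mulr0; apply: tends_eq => k.
have zc' : z k c' - z k c != 0 by apply: hne => //; exact: leq_ltn_trans ac'.
by rewrite mulrA divfK.
Qed.

(** The gap z_b - z_c is the sum of the consecutive gaps from b to c, and the last
one dominates. *)
Lemma gap_ratio b c' c : c = c'.+1 :> nat -> (0 < c')%N -> (b <= c')%N ->
  tends (fun k => (z k b - z k c) / (z k c' - z k c)) 1.
Proof.
move=> cc' c'0; have zc k : z k c' - z k c != 0 by exact: hne.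
have [N] := ubnP (c' - b); elim: N b => // N IHN b bN.
rewrite leq_eqVlt => /orP[/eqP/val_inj ->|bc].
  by apply: tends_eq => [k|]; [rewrite divff //|exact: tends_cst].
have bn : (b.+1 < n)%N by rewrite (leq_ltn_trans bc) // ltn_ord.
pose b1 : 'I_n := Ordinal bn.
have := IHN b1; rewrite subnS -ltnS prednK ?subn_gt0 // => /(_ bN bc) IH.
have := tendsD _ _ _ _ _ (step_ratio b b1 c' c erefl cc' bc) IH.
rewrite add0r; apply: tends_eq => k.
by rewrite -mulrDl addrA subrK.
Qed.

Lemma gap_near_neq0 b c : (b < c)%N -> (1 < c)%N ->
  \forall k \near \oo, z k b - z k c != 0.
Proof.
move=> bc c1; have [c' cc'] := pred_ordP c (ltnW c1).
have c'0 : (0 < c')%N by rewrite cc' in c1.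
have bc' : (b <= c')%N by rewrite cc' in bc.
apply: filterS (tends_neq0 _ _ _ (oner_neq0 _) (gap_ratio _ _ _ cc' c'0 bc')) => k.
by apply: contraNneq => ->; rewrite mul0r.
Qed.

Lemma gap_pred_near_neq0 a a' : a = a'.+1 :> nat ->
  \forall k \near \oo, gap K n (z k) a a' != 0.
Proof.
move=> aa'.
have : \forall k \near \oo, forall c, (c != a) && (c != a') -> z k a - z k c != 0.
  apply: filter_forall => c; have [/andP[ca ca']|_] := boolP (_ && _); last first.
    by apply: nearW.
  have [ac|ac] := ltnP a c.
    apply: filterS (gap_near_neq0 a c ac _) => [k zk _ //|].
    by rewrite (leq_ltn_trans _ ac) // aa'.
  have ca'lt : (c < a')%N.
    by rewrite ltn_neqAle ca' -ltnS -aa' ltn_neqAle ca.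
  apply: filterS (gap_near_neq0 c a _ _) => [k zk _||].
  - by rewrite -opprB oppr_eq0.
  - by rewrite ltn_neqAle ca.
  - by rewrite aa' ltnS (leq_ltn_trans _ ca'lt).
apply: filterS => k zk; apply/prodf_neq0 => c; exact: zk.
Qed.

(** All factors but one cancel, leaving (z_a - z_a') / (z_a - z_b); its numerator
dominates the differences z_a' - z_b for b < a', and is negligible against
z_a - z_b for b > a. *)
Lemma gap_tends a a' b : a = a'.+1 :> nat -> b != a ->
  tends (fun k => gap K n (z k) a b / gap K n (z k) a a') (b < a)%N%:R.
Proof.
move=> aa' ba; have ga := gap_pred_near_neq0 a a' aa'.
have a'a : a' != a by apply/eqP => a'E; move: aa'; rewrite a'E => /n_Sn.
have [->|ba'] := eqVneq b a'.
  rewrite aa' ltnSn; apply: (tends_near _ _ (fun=> 1)); last exact: tends_cst.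
  by apply: filterS ga => k; exact: divff.
have ratioE : \forall k \near \oo, gap K n (z k) a b / gap K n (z k) a a' =
    (z k a - z k a') / (z k a - z k b).
  apply: filterS ga => k; rewrite /gap (bigD1 b) ?ba //= => /[dup].
  rewrite mulf_eq0 negb_or => /andP[_ R0] _.
  rewrite [X in X / _](bigD1 a') /=; last by rewrite a'a eq_sym.
  rewrite [X in _ * X / _](eq_bigl (fun c => (c != a) && (c != a') && (c != b))).
    by rewrite -mulf_div divff // mulr1.
  by move=> c; rewrite -!andbA [(c != b) && _]andbC.
apply: tends_near ratioE _.
have a0 : (0 < a)%N by rewrite aa'.
have [blta|] := ltnP b a.
  have ba'lt : (b < a')%N by rewrite ltn_neqAle ba' -ltnS -aa'.
  have a'0 : (0 < a')%N by exact: leq_ltn_trans ba'lt.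
  have := tendsV _ _ _ (oner_neq0 _) (gap_ratio b a' a aa' a'0 (ltnW ba'lt)).
  by rewrite invr1; apply: tends_eq => k; rewrite invf_div -mulrNN -invrN !opprB.
rewrite leq_eqVlt => /orP[/eqP/val_inj ab|ab]; first by rewrite ab eqxx in ba.
have [b' bb'] := pred_ordP b (leq_ltn_trans (leq0n _) ab).
have ab' : (a <= b')%N by rewrite bb' in ab.
have b'0 : (0 < b')%N by exact: leq_trans ab'.
have zb k : z k b' - z k b != 0 by exact: hne.
have a'b' : (a' < b')%N by rewrite -aa'.
have := tendsM _ _ _ _ _ (tendsN _ _ _ (step_ratio a' a b' b aa' bb' a'b'))
  (tendsV _ _ _ (oner_neq0 _) (gap_ratio a b' b bb' b'0 ab')).
rewrite oppr0 mul0r; apply: tends_eq => k.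
by rewrite invf_div -mulNr opprB mulrA divfK.
Qed.

End GapLimits.

(** * The limit of the Bethe algebra *)

Section GroupAlgebraTends.
Import VectorInternalTheory.
Variables (K : numFieldType) (gT : finGroupType).
Local Notation A := (group_alg K gT).
Local Notation e := (ga_elt K).

Definition ga_tends (x_ : nat -> A) (x : A) : Prop :=
  forall g, tends K (fun k => x_ k g) (x g).

Lemma ga_tends_cst x : ga_tends (fun=> x) x.
Proof. by move=> g; exact: tends_cst. Qed.

Lemma ga_tendsD x_ y_ x y :
  ga_tends x_ x -> ga_tends y_ y -> ga_tends (fun k => x_ k + y_ k) (x + y).
Proof.
move=> xx yy g; rewrite ga_addE; apply: tends_eq => [k|]; first by rewrite ga_addE.
exact: tendsD.
Qed.

Lemma ga_tendsZ (u : nat -> K) l x_ x :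
  tends K u l -> ga_tends x_ x -> ga_tends (fun k => u k *: x_ k) (l *: x).
Proof.
move=> ul xx g; rewrite ga_scaleE; apply: tends_eq => [k|]; first by rewrite ga_scaleE.
exact: tendsM.
Qed.

Lemma ga_tendsN x_ x : ga_tends x_ x -> ga_tends (fun k => - x_ k) (- x).
Proof.
move=> xx g; rewrite ga_oppE; apply: tends_eq => [k|]; first by rewrite ga_oppE.
exact: tendsN.
Qed.

Lemma ga_tendsM x_ y_ x y :
  ga_tends x_ x -> ga_tends y_ y -> ga_tends (fun k => x_ k * y_ k) (x * y).
Proof.
move=> xx yy g; rewrite ga_mulE; apply: tends_eq => [k|]; first by rewrite ga_mulE.
by apply: tends_sum => h _; exact: tendsM.
Qed.

Lemma ga_tends_sum (I : Type) (r : seq I) (P : pred I) (F : I -> nat -> A) (l : I -> A) :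
  (forall i, P i -> ga_tends (F i) (l i)) ->
  ga_tends (fun k => \sum_(i <- r | P i) F i k) (\sum_(i <- r | P i) l i).
Proof.
move=> Fl g; rewrite ga_sum_ffunE; apply: tends_eq => [k|].
  by rewrite ga_sum_ffunE.
by apply: tends_sum => i Pi; exact: Fl.
Qed.

Lemma ga_vtends x_ x : ga_tends x_ x -> vtends K A x_ x.
Proof.
move=> xx j; pose c g := v2r (e g : A) 0 j.
have cE y : v2r y 0 j = \sum_g y g * c g.
  rewrite {1}(ga_expand _ _ y) linear_sum summxE; apply: eq_bigr => g _.
  by rewrite linearZ mxE.
rewrite cE; apply: tends_eq => [k|]; first by rewrite cE.
by apply: tends_sum => g _; apply: tendsM; [exact: xx|exact: tends_cst].
Qed.

Definition ad (y : A) : 'End(A) := amull y - amulr y.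

Lemma adE y x : ad y x = y * x - x * y.
Proof. by rewrite add_lfunE opp_lfunE !lfunE. Qed.

Lemma ad_tends x_ x y_ y :
  ga_tends y_ y -> ga_tends x_ x -> ga_tends (fun k => ad (y_ k) (x_ k)) (ad y x).
Proof.
move=> yy xx g; rewrite adE; apply: tends_eq => [k|]; first by rewrite adE.
by apply: ga_tendsD; [exact: ga_tendsM|apply: ga_tendsN; exact: ga_tendsM].
Qed.

End GroupAlgebraTends.

Section BetheLimit.
Variables (K : numClosedFieldType) (n : nat) (z : nat -> 'I_n -> K).
Local Notation A := (group_alg K 'S_n).
Local Notation e := (ga_elt K).
Local Notation star := (star K 'S_n).
Local Notation JM := (JM K n).
Local Notation ga_tends := (ga_tends K 'S_n).
Local Notation ad := (ad K 'S_n).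
Implicit Types a b c : 'I_n.

Definition ad_square_sum (y : 'I_n -> A) : 'End(A) := \sum_a (ad (y a) \o ad (y a))%VF.

Lemma ad_square_sumE y x : ad_square_sum y x = \sum_a ad (y a) (ad (y a) x).
Proof. by rewrite sum_lfunE; apply: eq_bigr => a _; rewrite comp_lfunE. Qed.

(** As X_a is self-adjoint, so is ad(X_a), and the inner product of x with the sum
of the ad(X_a)^2 x is the sum of the squared norms of the ad(X_a) x. *)
Lemma lker_ad_square_sum_JM : (lker (ad_square_sum JM) <= JMalg K n n)%VS.
Proof.
apply/subvP => x; rewrite memv_ker ad_square_sumE => /eqP adx.
have ad0 a : ad (JM a) x = 0.
  suff d0 : star (ad (JM a) x) = 0 by rewrite -[LHS]starK d0 star0.
  apply: (@star_sq_sum_eq0 K _ _ (fun a => star (ad (JM a) x))) => //.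
  transitivity ((star x * \sum_a ad (JM a) (ad (JM a) x)) 1%g); last first.
    by rewrite adx mulr0 ga_0E.
  rewrite mulr_sumr ga_sum_ffunE; apply: eq_bigr => b _.
  rewrite starK; set d := ad (JM b) x.
  have -> : star d = star x * JM b - JM b * star x.
    by rewrite /d adE starB !starM star_JM.
  rewrite adE mulrBl mulrBr !ga_addE !ga_oppE !mulrA; congr (_ - _).
  by rewrite [RHS]ga_trace_comm !mulrA.
apply: JMalg_max_comm => // [g|d dJ]; first by rewrite Sym_below_full.
apply/esym; move: d dJ; apply: JMalg_ind => [|c u v ux vx|a u _ ux].
- by rewrite mul1r mulr1.
- by rewrite mulrDl mulrDr -scalerAl -scalerAr ux vx.
- have /eqP := ad0 a; rewrite adE subr_eq0 => /eqP xa.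
  by rewrite mulrA -xa -!mulrA ux.
Qed.

Section Approximants.
Variable y_ : nat -> 'I_n -> A.
Hypothesis y_bethe : forall k a, y_ k a \in bethe (z k).
Hypothesis y_comm : forall k a x, x \in bethe (z k) -> x * y_ k a = y_ k a * x.
Hypothesis y_JM : forall a, ga_tends (fun k => y_ k a) (JM a).

(** The limits of sequences of elements of the Bethe algebras form an algebra. *)
Lemma approx_JMalg x : x \in JMalg K n n ->
  exists x_, (forall k, x_ k \in bethe (z k)) /\ ga_tends x_ x.
Proof.
move: x; apply: JMalg_ind => [|c u v [u_ [uB uu]] [v_ [vB vv]]|a u _ [u_ [uB uu]]].
- by exists (fun=> 1); split=> [k|]; [exact: memv_agenv1|exact: ga_tends_cst].
- exists (fun k => c *: u_ k + v_ k); split=> [k|]; first by rewrite memvD ?memvZ.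
  by apply: ga_tendsD => //; apply: (ga_tendsZ _ _ (fun=> c)) => //; exact: tends_cst.
- exists (fun k => y_ k a * u_ k); split=> [k|].
    by apply: memv_agenvM; [exact: y_bethe|exact: uB].
  exact: ga_tendsM.
Qed.

(** Elements of the Bethe algebra are killed by every ad(y_a). *)
Lemma near_dim_bethe : \forall k \near \oo,
  (\dim (bethe (z k)) <= \dim (JMalg K n n))%N.
Proof.
have : \forall k \near \oo, (\dim (lker (ad_square_sum (y_ k))) <=
    \dim (lker (ad_square_sum JM)))%N.
  apply: near_dim_lker => x; apply: ga_vtends => g.
  rewrite ad_square_sumE; apply: tends_eq => [k|].
    by rewrite ad_square_sumE.
  move: g; apply: ga_tends_sum => a _; apply: ad_tends => //.
  by apply: ad_tends => //; exact: ga_tends_cst.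
apply: filterS => k dk; apply: leq_trans (dimvS lker_ad_square_sum_JM).
apply: leq_trans dk; apply: dimvS; apply/subvP => x xB.
rewrite memv_ker ad_square_sumE big1 // => a _.
by rewrite [X in ad _ X]adE (y_comm k a x xB) subrr linear0.
Qed.

Lemma bethe_tends :
  (\forall k \near \oo, \dim (bethe (z k)) = \dim (gelfand_zetlin K n)) /\
  ((bethe (z k) : grassmannian A) @[k --> \oo] -->
     (gelfand_zetlin K n : grassmannian A)).
Proof.
rewrite gelfand_zetlin_JMalg; apply: grassmannian_tends; last exact: near_dim_bethe.
move=> x /approx_JMalg[x_ [xB xx]]; exists x_; split=> //; exact: ga_vtends.
Qed.

End Approximants.

Hypothesis (hne : forall (b c : 'I_n) (k : nat),
  (0 < b)%N -> c = b.+1 :> nat -> z k b - z k c != 0).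
Hypothesis (hlim : forall a b c : 'I_n, b = a.+1 :> nat -> c = b.+1 :> nat ->
  tends K (fun k => (z k a - z k b) / (z k b - z k c)) 0).

Definition approx_JM (a a' : 'I_n) k : A :=
  (gap K n (z k) a a')^-1 *: hamiltonian K n (z k) a.

Lemma approx_JM_tends a a' : a = a'.+1 :> nat -> ga_tends (approx_JM a a') (JM a).
Proof.
move=> aa' g.
have -> : JM a = \sum_(b | b != a) (b < a)%N%:R *: e (tperm b a).
  rewrite /JM [RHS](bigID (fun b : 'I_n => (b < a)%N)) /= [X in _ + X]big1 ?addr0.
    apply: eq_big => [b|b ->]; last by rewrite scale1r.
    by rewrite andb_idl // => ba; rewrite neq_ltn ba.
  by move=> b /andP[_ /negPf->]; rewrite scale0r.
move: g; suff : ga_tends (fun k => \sum_(b | b != a)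
    (gap K n (z k) a b / gap K n (z k) a a') *: e (tperm b a))
    (\sum_(b | b != a) (b < a)%N%:R *: e (tperm b a)).
  move=> h g; apply: tends_eq (h g) => k; congr (fun_of_fin _ _).
  rewrite /approx_JM scaler_sumr; apply: eq_bigr => b _.
  by rewrite scalerA mulrC tpermC.
apply: ga_tends_sum => b ba; apply: ga_tendsZ; last exact: ga_tends_cst.
exact: gap_tends.
Qed.

(** The approximants of the X_a are the rescaled Hamiltonians; X_0 = 0 is
approximated by 0. *)
Lemma bethe_tends_gelfand_zetlin :
  (\forall k \near \oo, \dim (bethe (z k)) = \dim (gelfand_zetlin K n)) /\
  ((bethe (z k) : grassmannian A) @[k --> \oo] -->
     (gelfand_zetlin K n : grassmannian A)).
Proof.
have /choice[y yP] : forall a, exists y : nat -> A,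
    [/\ forall k, y k \in bethe (z k),
      forall k x, x \in bethe (z k) -> x * y k = y k * x & ga_tends y (JM a)].
  move=> a; have [a0|/pred_ordP[a' aa']] := leqP a 0.
    exists (fun=> 0); split=> [k|k x _|]; first exact: mem0v.
      by rewrite mulr0 mul0r.
    rewrite /JM big_pred0 => [|b]; first exact: ga_tends_cst.
    by apply/negbTE; rewrite -leqNgt (leq_trans a0).
  exists (approx_JM a a'); split=> [k|k x xB|]; last exact: approx_JM_tends.
    by rewrite memvZ // hamiltonian_in_bethe.
  by rewrite -scalerAl -scalerAr hamiltonian_comm_bethe.
apply: (bethe_tends (fun k a => y a k)) => [k a|k a x|a].
- by have [] := yP a.
- by have [_ yC _] := yP a; exact: yC.
- by have [] := yP a.
Qed.

End BetheLimit.

Local Open Scope complex_scope.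

Theorem proposition2p5 (R : realType) (n : nat) (z : nat -> 'I_n -> R[i])
  (hne : forall (b c : 'I_n) (k : nat),
    (0 < b)%N -> c = b.+1 :> nat -> z k b - z k c != 0)
  (hlim : forall a b c : 'I_n, b = a.+1 :> nat -> c = b.+1 :> nat ->
    (z k a - z k b) / (z k b - z k c) @[k --> \oo] --> (0 : R[i])) :
  (\forall k \near \oo, \dim (bethe (z k)) = \dim (gelfand_zetlin R[i] n)) /\
  ((bethe (z k) : grassmannian (group_alg R[i] 'S_n)) @[k --> \oo] -->
     (gelfand_zetlin R[i] n : grassmannian (group_alg R[i] 'S_n))).
Proof. exact: bethe_tends_gelfand_zetlin. Qed.
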